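(* Let $F:M^n\to\mathbb{R}^{n+1}$ ($n\ge2$) be an immersed bounded smooth minimal hypersurface with free boundary on a pinching cylinder $F_\Sigma:\Sigma\to\mathbb{R}^{n+1}$ with profile function $\omega_\Sigma$. If $F(M)\subset\Theta(z_1,z_2)$, where $\Theta(z_1,z_2)$ is a shrinking neck region, then $F(M)$ is a standard flat disk.
   Context: Points of $\mathbb{R}^{n+1}$ are written $(x,z)$, $x\in\mathbb{R}^n$, $z\in\mathbb{R}$; $Oz$ is the $z$-axis. Pinching cylinder: let $\omega_\Sigma:\mathbb{R}\to[0,\infty)$ be continuous, and smooth outside a finite (possibly empty) set $P=\{w_1,\dots,w_{n_p}\}$ of points with $\omega_\Sigma(w_i)=0$. Assume there is a compact set $K\supset P$ such that $z\frac{d\omega_\Sigma}{dz}(z)>0$ for all $z\in\mathbb{R}\setminus K$. The function $\omega_\Sigma$ generates, by rotation about $Oz$, the smooth rotationally symmetric hypersurface $F_\Sigma(\Sigma)=\{(x,z):|x|=\omega_\Sigma(z),\ z\notin P\}$, a disjoint union of $n_p+1$ cylinders, called a pinching cylinder. Its unit normal $\nu_\Sigma$ points away from the interior of the hypersurfaces supported on it. Minimal hypersurface with free boundary on $F_\Sigma$: a smooth immersion $F:M^n\to\mathbb{R}^{n+1}$ of a compact connected manifold with nonempty boundary, with mean curvature $H\equiv0$, $F(\partial M)\subset F_\Sigma(\Sigma)$ and $\langle\nu,\nu_\Sigma\rangle=0$ along $\partial M$, where $\nu$ is the unit normal of $F$. No assumption on topology, symmetry or graphicality is made. Bounded means that $F(M)$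 is a bounded set. Regions: for $z_1,z_2\in[-\infty,\infty]$, $\Theta(z_1,z_2)=\{(x,z):|x|<\omega_\Sigma(z),\ z\in(z_1,z_2)\}$. It is a shrinking neck region if for all $z\in(z_1,z_2)$, $\frac{d\omega_\Sigma}{dz}(z)=0$ implies that $\omega_\Sigma(z)$ is a weak local minimum value for $\omega_\Sigma$. Containment $F(M)\subset\Theta(z_1,z_2)$ means that all points $(x,z)\in F(M)$, boundary points included, satisfy $|x|\le\omega_\Sigma(z)$ and $z\in(z_1,z_2)$. A standard flat disk is $\{(x,z^* ):|x|\le\omega_\Sigma(z^* )\}$ for some $z^*$. *)

(* Defs.v *)
From HB Require Import structures.
From mathcomp Require Import all_boot all_order all_algebra.
From mathcomp Require Import all_classical all_reals all_analysis.
Set Implicit Arguments.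
Unset Strict Implicit.
Unset Printing Implicit Defensive.
Import Order.TTheory GRing.Theory Num.Theory.
Import numFieldNormedType.Exports.
Local Open Scope classical_set_scope.
Local Open Scope ring_scope.

(* The library norm on row vectors is the sup norm, so the Euclidean structure
   has to be introduced separately. *)
Definition dot (R : realType) (m : nat) (u v : 'rV[R]_m) : R :=
  \sum_(j < m) u 0 j * v 0 j.

Definition enorm (R : realType) (m : nat) (u : 'rV[R]_m) : R :=
  Num.sqrt (dot u u).

(* A point (x, z) of R^{n+1} is the row vector [row_mx x z%:M]. *)
Definition xpart (R : realType) (n : nat) (p : 'rV[R]_(n + 1)) : 'rV[R]_n :=
  lsubmx p.

Definition zpart (R : realType) (n : nat) (p : 'rV[R]_(n + 1)) : R :=
  p 0 (rshift n ord0).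

(* C^k maps on an open set U. *)
Fixpoint Ck (R : realType) (n m k : nat) (U : set 'rV[R]_n)
    (f : 'rV[R]_n -> 'rV[R]_m) {struct k} : Prop :=
  match k with
  | 0%N => forall q, U q -> {for q, continuous f}
  | k'.+1 => (forall q, U q -> differentiable f q) /\
      forall i : 'I_n, Ck k' U (fun q => 'D_(delta_mx 0 i) f q)
  end.

Definition smooth_on (R : realType) (n m : nat) (U : set 'rV[R]_n)
  (f : 'rV[R]_n -> 'rV[R]_m) : Prop := forall k, Ck k U f.

(* Smoothness on an arbitrary subset: local smooth extendability. *)
Definition smooth_within (R : realType) (n m : nat) (A : set 'rV[R]_n)
    (f : 'rV[R]_n -> 'rV[R]_m) : Prop :=
  forall q, A q -> exists (O : set 'rV[R]_n) (G : 'rV[R]_n -> 'rV[R]_m),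
    [/\ open O, O q, smooth_on O G & forall y, O y -> A y -> G y = f y].

(* The model half-space {q | q_0 >= 0} and its boundary hyperplane. The
   dimension n is arbitrary, so coordinate 0 is selected by its value. *)
Definition halfspace (R : realType) (n : nat) : set 'rV[R]_n :=
  [set q | forall j : 'I_n, j = 0%N :> nat -> 0 <= q 0 j].

Definition halfspace_bd (R : realType) (n : nat) : set 'rV[R]_n :=
  [set q | exists2 j : 'I_n, j = 0%N :> nat & q 0 j = 0].

(* i-th partial derivative of a map defined on a relatively open subset of the
   half-space: the increment h only ranges over values keeping q + h e_i in the
   half-space. It is the usual partial derivative at interior points, and
   one-sided in the direction e_0 at points of the boundary hyperplane. *)
Definition hpartial (R : realType) (n m : nat) (i : 'I_n)
    (f : 'rV[R]_n -> 'rV[R]_m) (q : 'rV[R]_n) : 'rV[R]_m :=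
  lim ((fun h : R => h^-1 *: (f (q + h *: delta_mx 0 i) - f q)) @
    within [set h : R | halfspace (q + h *: delta_mx 0 i)] (0 : R)^').

(* [chart_map] matters only on [chart_dom], and its inverse [chart_inv] only on
   the image [chart_cod]. *)
Record chart (R : realType) (M : topologicalType) (n : nat) := Chart {
  chart_dom : set M ;
  chart_map : M -> 'rV[R]_n ;
  chart_inv : 'rV[R]_n -> M }.

Definition chart_cod (R : realType) (M : topologicalType) (n : nat)
  (c : chart R M n) : set 'rV[R]_n := chart_map c @` chart_dom c.

Record is_chart (R : realType) (M : topologicalType) (n : nat)
    (c : chart R M n) : Prop := IsChart {
  chart_dom_open : open (chart_dom c) ;
  chart_cod_open : exists2 O : set 'rV[R]_n,
    open O & chart_cod c = O `&` halfspace (R:=R) (n:=n) ;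
  chart_mapK : forall p, chart_dom c p -> chart_inv c (chart_map c p) = p ;
  chart_map_cont : {within chart_dom c, continuous (chart_map c)} ;
  chart_inv_cont : {within chart_cod c, continuous (chart_inv c)} }.

(* A smooth n-manifold with (possibly empty) boundary. Second countability is
   not listed: it is automatic for the compact manifolds considered below. *)
Record smooth_manifold (R : realType) (M : topologicalType) (n : nat)
    (A : set (chart R M n)) : Prop := SmoothManifold {
  mfd_hausdorff : hausdorff_space M ;
  mfd_chart : forall c, A c -> is_chart c ;
  mfd_cover : forall p : M, exists2 c, A c & chart_dom c p ;
  mfd_compat : forall c c', A c -> A c' ->
    smooth_within (chart_map c @` (chart_dom c `&` chart_dom c'))
      (chart_map c' \o chart_inv c) }.

Definition mfd_boundary (R : realType) (M : topologicalType) (n : nat)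
    (A : set (chart R M n)) : set M :=
  [set p | exists c, [/\ A c, chart_dom c p & halfspace_bd (chart_map c p)]].

Section LocalGeometry.
Variables (R : realType) (n : nat).
Variable X : 'rV[R]_n -> 'rV[R]_(n + 1).

(* Row i is the tangent vector d_i X. *)
Definition tangent_mx (q : 'rV[R]_n) : 'M[R]_(n, n + 1) :=
  \matrix_(i < n) hpartial i X q.

Definition metric (q : 'rV[R]_n) : 'M[R]_n :=
  tangent_mx q *m (tangent_mx q)^T.

Definition unit_normal (q : 'rV[R]_n) (nu : 'rV[R]_(n + 1)) : Prop :=
  (forall i, dot (hpartial i X q) nu = 0) /\ dot nu nu = 1.

Definition second_form (q : 'rV[R]_n) (nu : 'rV[R]_(n + 1)) : 'M[R]_n :=
  \matrix_(i < n, j < n) dot (hpartial i (hpartial j X) q) nu.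

(* g^{ij} h_ij *)
Definition mean_curvature (q : 'rV[R]_n) (nu : 'rV[R]_(n + 1)) : R :=
  \tr (invmx (metric q) *m second_form q nu).

End LocalGeometry.

Definition smooth_immersion (R : realType) (M : topologicalType) (n : nat)
    (A : set (chart R M n)) (F : M -> 'rV[R]_(n + 1)) : Prop :=
  forall c, A c ->
    smooth_within (chart_cod c) (F \o chart_inv c) /\
    forall q, chart_cod c q -> row_free (tangent_mx (F \o chart_inv c) q).

(* The unit normal is determined up to sign at each point, and H = 0 does not
   depend on the sign, so no orientation of M is needed. *)
Definition minimal (R : realType) (M : topologicalType) (n : nat)
    (A : set (chart R M n)) (F : M -> 'rV[R]_(n + 1)) : Prop :=
  forall c, A c -> forall q, chart_cod c q -> forall nu,
    unit_normal (F \o chart_inv c) q nu ->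
    mean_curvature (F \o chart_inv c) q nu = 0.

(* Positivity off P expresses that {|x| = w(z), z \notin P} is a smooth
   hypersurface made of #|P| + 1 cylinders, pinched exactly at the points of
   P. *)
Record pinching_profile (R : realType) (w : R -> R) (P : set R) : Prop :=
  PinchingProfile {
  profile_cont : continuous w ;
  profile_ge0 : forall z, 0 <= w z ;
  profile_finite : finite_set P ;
  profile_pinch : forall z, P z -> w z = 0 ;
  profile_gt0 : forall z, ~ P z -> 0 < w z ;
  profile_smooth : forall (k : nat) z, ~ P z -> derivable (derive1n k w) z 1 ;
  profile_growth : exists K : set R,
    [/\ compact K, P `<=` K & forall z, ~ K z -> 0 < z * derive1 w z] }.

Definition pinching_cylinder (R : realType) (n : nat) (w : R -> R)
    (P : set R) : set 'rV[R]_(n + 1) :=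
  [set p | enorm (xpart p) = w (zpart p) /\ ~ P (zpart p)].

(* The normalized gradient of |x| - w(z), pointing out of {|x| < w(z)}. *)
Definition cylinder_normal (R : realType) (n : nat) (w : R -> R)
    (p : 'rV[R]_(n + 1)) : 'rV[R]_(n + 1) :=
  (Num.sqrt (1 + derive1 w (zpart p) ^+ 2))^-1 *:
  row_mx ((enorm (xpart p))^-1 *: xpart p) (- derive1 w (zpart p))%:M.

Record free_boundary (R : realType) (M : topologicalType) (n : nat)
    (A : set (chart R M n)) (F : M -> 'rV[R]_(n + 1)) (w : R -> R)
    (P : set R) : Prop := FreeBoundary {
  fb_incl : F @` mfd_boundary A `<=` pinching_cylinder (n:=n) w P ;
  fb_orth : forall c, A c -> forall p, chart_dom c p -> mfd_boundary A p ->
    forall nu, unit_normal (F \o chart_inv c) (chart_map c p) nu ->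
    dot nu (cylinder_normal w (F p)) = 0 }.

Record minimal_free_boundary (R : realType) (M : topologicalType) (n : nat)
    (A : set (chart R M n)) (F : M -> 'rV[R]_(n + 1)) (w : R -> R)
    (P : set R) : Prop := MinimalFreeBoundary {
  mfb_manifold : smooth_manifold A ;
  mfb_compact : compact [set: M] ;
  mfb_connected : connected [set: M] ;
  mfb_boundary : mfd_boundary A !=set0 ;
  mfb_immersion : smooth_immersion A F ;
  mfb_minimal : minimal A F ;
  mfb_free : free_boundary A F w P }.

(* S `<=` Theta(z1, z2) in the sense in which points of S are allowed to lie on
   the lateral boundary |x| = w(z). *)
Definition contained_in_region (R : realType) (n : nat) (w : R -> R)
    (z1 z2 : \bar R) (S : set 'rV[R]_(n + 1)) : Prop :=
  forall p, S p -> enorm (xpart p) <= w (zpart p) /\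
    (z1 < (zpart p)%:E < z2)%E.

Definition shrinking_neck (R : realType) (w : R -> R) (z1 z2 : \bar R) : Prop :=
  forall z : R, (z1 < z%:E < z2)%E -> is_derive z (1 : R) w 0 ->
    \forall y \near z, w z <= w y.

Definition standard_flat_disk (R : realType) (n : nat) (w : R -> R)
    (S : set 'rV[R]_(n + 1)) : Prop :=
  exists zs : R, S = [set p | enorm (xpart p) <= w zs /\ zpart p = zs].

(* Main.v *)
Require Import Defs.
From mathcomp Require Import all_boot all_order all_algebra.
From mathcomp Require Import all_classical all_reals all_analysis.
From mathcomp Require Import ring lra.
Set Implicit Arguments.
Unset Strict Implicit.
Unset Printing Implicit Defensive.
Import Order.TTheory GRing.Theory Num.Theory.
Import numFieldNormedType.Exports.
Local Open Scope classical_set_scope.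
Local Open Scope ring_scope.

(** The height [z] is constant on the hypersurface by the maximum principle, and
    the shape of the profile excludes every alternative.

    In a chart, minimality turns into a linear elliptic equation for each
    coordinate of the immersion, with continuous coefficients and no term of
    order zero ([minimal_elliptic]). The strong maximum principle ([strong_max],
    resting on Hopf's lemma [hopf]) shows that the set where [z] attains its
    maximum is open, also near boundary points, as soon as the gradient of [z]
    vanishes on that set. At interior points this is automatic. At a boundary
    point, the free boundary condition makes the normal of the cylinder tangent
    to the hypersurface, so that the inner derivative of [z] there has the sign
    of [w'] ([boundary_max]); being nonpositive at a maximum, it vanishes unless
    [w' < 0]. As the manifold is connected, either [z] is constant or its maximum
    is attained at a height with [w' < 0], and symmetrically either [z] is
    constant or its minimum is attained at a height with [w' > 0]
    ([height_dichotomy]). If [z] is not constant, then [w] has an interior maximum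
    between these two heights, and the leftmost one is a critical point which is
    not a weak local minimum: this contradicts the shrinking neck condition
    ([no_interior_hump]).

    It remains to see that a flat hypersurface fills the disk of radius [w z]. If
    a point [y] of the disk were missed, the function
    [(w z ^ 2 - |x| ^ 2) / |x - y| ^ 2] would attain a positive maximum on the
    hypersurface, necessarily at an interior point; there the projection to the
    hyperplane is a local diffeomorphism, so the gradient in [x] vanishes, which
    places [y] outside the disk ([disk_covered]). *)

(** * One-variable calculus *)

Section OneVariable.
Variable R : realType.
Implicit Types (f df : R -> R) (d x : R).

Lemma nbhs0_itv (P : R -> Prop) : (\forall t \near (0 : R), P t) ->
  exists2 e, 0 < e & forall t, `|t| < e -> P t.
Proof.
by case/nbhs_ballP => e /= e0 He; exists e => // t te; apply: He;
  rewrite -ball_normE /= sub0r normrN.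
Qed.

Lemma is_derive_gt0_quotient f d : is_derive (0 : R) (1 : R) f d -> 0 < d ->
  exists2 e, 0 < e & forall h, h != 0 -> `|h| < e -> 0 < h^-1 * (f h - f 0).
Proof.
move=> [df fd] d0.
have cv : (fun h : R => h^-1 *: (f (h *: 1 + 0) - f 0)) @ 0^' --> d.
  by rewrite -fd; exact: df.
have /cvgr_gt /(_ _ d0) := cv.
case/nbhs_ballP => e /= e0 He; exists e => // h h0 he.
have := He h; rewrite -ball_normE /= sub0r normrN => /(_ he h0).
by rewrite addr0 [h%:A]mulr1.
Qed.

Lemma is_derive_right_le f d : is_derive (0 : R) (1 : R) f d ->
  (\forall h \near (0 : R), 0 < h -> f h <= f 0) -> d <= 0.
Proof.
move=> fd /nbhs0_itv[e e0 He]; rewrite leNgt; apply/negP => d0.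
have [r r0 Hr] := is_derive_gt0_quotient fd d0.
pose h := Num.min e r / 2.
have m0 : 0 < Num.min e r by rewrite lt_min e0 r0.
have h0 : 0 < h by rewrite divr_gt0.
have hm : h < Num.min e r by rewrite /h; lra.
move: hm; rewrite lt_min => /andP[he hr].
have := Hr h; rewrite gt_eqF // gtr0_norm // => /(_ isT hr).
rewrite pmulr_rgt0 ?invr_gt0 // subr_gt0 ltNge => /negP; apply.
by apply: He => //; rewrite gtr0_norm.
Qed.

Lemma is_derive_flip f d : is_derive (0 : R) (1 : R) f d ->
  is_derive (0 : R) (1 : R) (fun h => f (- h)) (- d).
Proof.
move=> fd.
have fd' : is_derive (- (0 : R)) 1 f d by rewrite oppr0.
have ng : is_derive (0 : R) (1 : R) (fun h : R => - h) (- 1) by exact: is_deriveNid.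
have H := @is_derive1_comp R f (fun h => - h) 0 d (- 1) fd' ng.
by apply: is_derive_eq H _; rewrite mulrN1.
Qed.

Lemma is_derive_max f d : is_derive (0 : R) (1 : R) f d ->
  (\forall h \near (0 : R), f h <= f 0) -> d = 0.
Proof.
move=> fd Hf; apply/eqP; rewrite eq_le; apply/andP; split.
  by apply: is_derive_right_le fd _; apply: filterS Hf.
rewrite -oppr_le0; apply: is_derive_right_le (is_derive_flip fd) _.
have /nbhs0_itv[e e0 He] := Hf.
apply/nbhs_ballP; exists e => //= h; rewrite -ball_normE /= sub0r normrN => he _.
by rewrite oppr0; apply: He; rewrite normrN.
Qed.

(** First and second order necessary conditions at a local maximum; [f] need
    only be differentiable near the point, with derivative [df] differentiable
    at the point. *)
Lemma second_derivative_test f df d :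
  (\forall t \near (0 : R), is_derive (t : R) (1 : R) f (df t)) ->
  is_derive (0 : R) (1 : R) df d -> (\forall t \near (0 : R), f t <= f 0) ->
  df 0 = 0 /\ d <= 0.
Proof.
move=> fdf dfd fmax.
have df0 : df 0 = 0 by apply: is_derive_max fmax; exact: nbhs_singleton fdf.
split=> //; rewrite leNgt; apply/negP => d0.
have [r r0 Hr] := is_derive_gt0_quotient dfd d0.
have [e e0 He] : exists2 e, 0 < e & forall t, `|t| < e ->
    is_derive (t : R) (1 : R) f (df t) /\ f t <= f 0.
  by apply: nbhs0_itv; apply: filterI fdf fmax.
pose h := Num.min e r / 2.
have m0 : 0 < Num.min e r by rewrite lt_min e0 r0.
have h0 : 0 < h by rewrite divr_gt0.
have hm : h < Num.min e r by rewrite /h; lra.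
move: hm; rewrite lt_min => /andP[he hr].
have small t : 0 <= t -> t <= h -> `|t| < e.
  by move=> t0 th; rewrite ger0_norm //; lra.
have [||c] := @MVT _ f df 0 h h0.
- move=> x; rewrite in_itv /= => /andP[x0 xh].
  by apply: (He x _).1; apply: small; exact: ltW.
- apply: continuous_in_subspaceT => x; rewrite inE /= in_itv /= => /andP[x0 xh].
  have [[fx _] _] := He x (small _ x0 xh).
  by apply: differentiable_continuous; apply/derivable1_diffP.
rewrite in_itv /= => /andP[c0 ch] E.
have := Hr c; rewrite gt_eqF // gtr0_norm // df0 subr0 => /(_ isT (lt_trans ch hr)).
rewrite pmulr_rgt0 ?invr_gt0 // => dc.
have [_ fh] := He h (small _ (ltW h0) (lexx _)).
have : 0 < df c * (h - 0) by rewrite subr0 mulr_gt0.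
by rewrite -E subr_gt0 ltNge fh.
Qed.

End OneVariable.

(** * Euclidean linear algebra *)

Section Dot.
Variables (R : realType) (m : nat).
Implicit Types (u v x y : 'rV[R]_m) (a : R).

Lemma dotC u v : dot u v = dot v u.
Proof. by apply: eq_bigr => j _; rewrite mulrC. Qed.

Lemma dotDl u v x : dot (u + v) x = dot u x + dot v x.
Proof. by rewrite /dot -big_split; apply: eq_bigr => j _; rewrite mxE mulrDl. Qed.

Lemma dotZl a u x : dot (a *: u) x = a * dot u x.
Proof. by rewrite /dot mulr_sumr; apply: eq_bigr => j _; rewrite mxE mulrA. Qed.

Lemma dotNl u x : dot (- u) x = - dot u x.
Proof. by rewrite -scaleN1r dotZl mulN1r. Qed.

Lemma dotDr u v x : dot x (u + v) = dot x u + dot x v.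
Proof. by rewrite dotC dotDl !(dotC x). Qed.

Lemma dotZr a u x : dot x (a *: u) = a * dot x u.
Proof. by rewrite dotC dotZl dotC. Qed.

Lemma dotNr u x : dot x (- u) = - dot x u.
Proof. by rewrite dotC dotNl dotC. Qed.

(** Expansion of inner products by bilinearity. *)
Definition dotE := (dotDl, dotDr, dotNl, dotNr, dotZl, dotZr).

Lemma dot_suml (I : Type) (r : seq I) (f : I -> 'rV[R]_m) x :
  dot (\sum_(i <- r) f i) x = \sum_(i <- r) dot (f i) x.
Proof.
elim: r => [|i r IH]; last by rewrite !big_cons dotDl IH.
by rewrite !big_nil /dot big1 // => j _; rewrite mxE mul0r.
Qed.

Lemma dot_delta u (i : 'I_m) : dot u (delta_mx 0 i) = u 0 i.
Proof.
rewrite /dot (bigD1 i) //= big1 ?addr0; first by rewrite mxE !eqxx mulr1.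
by move=> j ji; rewrite mxE eqxx (negPf ji) mulr0.
Qed.

Lemma dot_deltal u (i : 'I_m) : dot (delta_mx 0 i) u = u 0 i.
Proof. by rewrite dotC dot_delta. Qed.

Lemma dot_ge0 u : 0 <= dot u u.
Proof. by apply: sumr_ge0 => j _; rewrite -expr2 sqr_ge0. Qed.

Lemma dot_eq0 u : (dot u u == 0) = (u == 0).
Proof.
apply/eqP/eqP => [|->]; last by rewrite /dot big1 // => j _; rewrite mxE mul0r.
move=> /eqP; rewrite psumr_eq0 => [/allP h|j _]; last by rewrite -expr2 sqr_ge0.
apply/rowP => j; rewrite mxE; have := h j (mem_index_enum _).
by rewrite -expr2 sqrf_eq0 => /eqP.
Qed.

Lemma dot0r u : dot u 0 = 0.
Proof. by rewrite /dot big1 // => j _; rewrite mxE mulr0. Qed.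

Lemma dot00 : dot (0 : 'rV[R]_m) 0 = 0.
Proof. exact: dot0r. Qed.

Lemma dot_gt0 u : (0 < dot u u) = (u != 0).
Proof. by rewrite lt_def dot_ge0 andbT dot_eq0. Qed.

Lemma sqr_coord_le_dot u j : u 0 j ^+ 2 <= dot u u.
Proof.
rewrite /dot (bigD1 j) //= expr2 lerDl.
by apply: sumr_ge0 => i _; rewrite -expr2 sqr_ge0.
Qed.

Lemma dot_add_le u v : dot (u + v) (u + v) <= 2 * dot u u + 2 * dot v v.
Proof. by have := dot_ge0 (u - v); rewrite !dotE (dotC v u); lra. Qed.

Lemma dot_convex u v a : 0 <= a -> a <= 1 ->
  dot ((1 - a) *: u + a *: v) ((1 - a) *: u + a *: v) <=
  (1 - a) * dot u u + a * dot v v.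
Proof.
move=> a0 a1; have : 0 <= a * (1 - a) * dot (u - v) (u - v).
  by rewrite !mulr_ge0 ?dot_ge0 // subr_ge0.
rewrite !dotE (dotC v u); lra.
Qed.

Lemma enorm_le u a : 0 <= a -> (enorm u <= a) = (dot u u <= a ^+ 2).
Proof.
move=> a0; rewrite /enorm -[in LHS](ger0_norm a0) -sqrtr_sqr ler_sqrt //.
exact: sqr_ge0.
Qed.

Lemma sqr_enorm u : enorm u ^+ 2 = dot u u.
Proof. by rewrite sqr_sqrtr ?dot_ge0. Qed.

Lemma dot_mulmx u v : dot u v = (u *m v^T) 0 0.
Proof. by rewrite mxE; apply: eq_bigr => j _; rewrite mxE. Qed.

(** The closed ball with diameter from [x] to [y] is contained, except for the
    point [y], in the open ball around [x] whose boundary contains [y]. *)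
Lemma inner_ball_lt x y p :
  let c := 2^-1 *: (x + y) in
  dot (p - c) (p - c) <= dot (y - c) (y - c) -> p != y ->
  dot (p - x) (p - x) < dot (y - x) (y - x).
Proof.
move=> c H py.
have : 0 < dot (p - y) (p - y) by rewrite dot_gt0 subr_eq0.
move: H; rewrite /c !dotE (dotC y x) (dotC y p) (dotC x p); lra.
Qed.

End Dot.

Section Split.
Variables (R : realType) (n : nat).
Implicit Types (p : 'rV[R]_(n + 1)).

Lemma xpartE p j : xpart p 0 j = p 0 (lshift 1 j).
Proof. by rewrite mxE. Qed.

Lemma dot_split p p' :
  dot p p' = dot (xpart p) (xpart p') + zpart p * zpart p'.
Proof.
rewrite /dot big_split_ord /= big_ord1; congr (_ + _).
by apply: eq_bigr => j _; rewrite !xpartE.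
Qed.

Lemma xpart_row_mx (x : 'rV[R]_n) (y : 'rV[R]_1) : xpart (row_mx x y) = x.
Proof. exact: row_mxKl. Qed.

Lemma zpart_row_mx (x : 'rV[R]_n) (y : 'rV[R]_1) : zpart (row_mx x y) = y 0 0.
Proof. by rewrite /zpart row_mxEr. Qed.

Lemma zpartZ (a : R) p : zpart (a *: p) = a * zpart p.
Proof. by rewrite /zpart mxE. Qed.

End Split.

Lemma unitmx_gram (R : realType) (k m : nat) (T : 'M[R]_(k, m)) :
  row_free T -> T *m T^T \in unitmx.
Proof.
move=> fT; rewrite -row_free_unit; apply/row_freeP.
have : kermx (T *m T^T) = 0.
  apply/eqP/rowV0P => v /sub_kermxP vK.
  have : dot (v *m T) (v *m T) == 0.
    by rewrite dot_mulmx trmx_mul !mulmxA -(mulmxA v) vK mul0mx mxE.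
  rewrite dot_eq0 => /eqP vT.
  by apply: (row_free_inj fT); rewrite vT mul0mx.
move/eqP; rewrite kermx_eq0 => /row_freeP[B HB]; by exists B.
Qed.

(** A vector orthogonal to every unit vector normal to the row space of [T]
    lies in that row space, with coefficients given by the Gram matrix. *)
Lemma row_space_of_normals (R : realType) (k m : nat) (T : 'M[R]_(k, m))
    (W : 'rV[R]_m) : row_free T ->
  (forall nu, (forall i, dot (row i T) nu = 0) -> dot nu nu = 1 ->
     dot W nu = 0) ->
  W = (W *m T^T *m invmx (T *m T^T)) *m T.
Proof.
move=> fT HW; set c := _ *m invmx _.
have gu := unitmx_gram fT.
have perp : (W - c *m T) *m T^T = 0.
  by rewrite mulmxBl /c -!mulmxA mulVmx // mulmx1 subrr.
set V := W - c *m T in perp.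
apply/eqP; rewrite -subr_eq0 -/V; apply: contraT; rewrite -dot_gt0 => V0.
have rowV i : dot (row i T) V = 0.
  rewrite dotC dot_mulmx tr_row.
  have := congr1 (fun A : 'rV_k => A 0 i) perp.
  by rewrite !mxE => E; rewrite -[RHS]E; apply: eq_bigr => j _; rewrite !mxE.
have V1 : (enorm V)^-1 ^+ 2 * dot V V = 1.
  by rewrite exprVn sqr_enorm mulVf // gt_eqF.
have e0 : (enorm V)^-1 != 0.
  by rewrite invr_eq0 -sqrf_eq0 sqr_enorm gt_eqF.
have : dot W ((enorm V)^-1 *: V) = 0.
  apply: HW => [i|]; first by rewrite dotZr rowV mulr0.
  by rewrite dotZl dotZr mulrA -expr2.
rewrite dotZr => /eqP; rewrite mulf_eq0 (negPf e0) /= => /eqP WV.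
have : dot (c *m T) V = 0.
  by rewrite dotC dot_mulmx trmx_mul mulmxA perp mul0mx mxE.
have -> : c *m T = W - V by rewrite /V opprB addrC subrK.
by rewrite dotDl dotNl WV sub0r => /eqP; rewrite oppr_eq0 gt_eqF.
Qed.

(** Linear algebra behind the equation satisfied by the coordinates of a
    minimal immersion: row [i] of [T] is the first derivative in direction [i],
    [X i j] the mixed second derivative. With [g] the Gram matrix of [T],
    minimality says that the sum of the [X j i] weighted by the entries of the
    inverse of [g] is tangential. The inverse is replaced throughout by the
    adjugate, so that all coefficients are polynomial in [T] and [X] and hence
    depend continuously on the point. *)
Section EllipticIdentity.
Variables (R : realType) (k m : nat) (T : 'M[R]_(k, m))
  (X : 'I_k -> 'I_k -> 'rV[R]_m).

(** The inverse metric up to the factor [\det g]. *)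
Definition gram_adj : 'M[R]_k := \adj (T *m T^T).

(** A square root of the coefficient matrix of the second-order part: its
    product with its own transpose is [\det g] times the transpose of
    [gram_adj]. *)
Definition elliptic_root : 'M[R]_(k, m) := gram_adj *m T.

(** The metric trace of the second derivatives, up to the factor [\det g]. *)
Definition gram_trace : 'rV[R]_m := \sum_i \sum_j gram_adj i j *: X j i.

(** Coefficients of the first-order part: the coordinates of [gram_trace] in
    the tangent basis, up to the factor [\det g]. *)
Definition drift : 'rV[R]_k := gram_trace *m T^T *m gram_adj.

(** Nondegeneracy of the second-order part. *)
Lemma elliptic_root_free : row_free T -> forall v : 'rV[R]_k,
  v *m elliptic_root = 0 -> v = 0.
Proof.
move=> fT v; rewrite /elliptic_root mulmxA => vT.
have {}vT : v *m gram_adj = 0 by apply: (row_free_inj fT); rewrite vT mul0mx.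
have := congr1 (mulmx^~ (T *m T^T)) vT.
rewrite /= -mulmxA mul_adj_mx mul0mx mul_mx_scalar => /eqP.
have := unitmx_gram fT; rewrite unitmxE unitfE => d0.
by rewrite scaler_eq0 (negPf d0) => /eqP.
Qed.

Lemma elliptic_identity : row_free T ->
  (forall nu, (forall i, dot (row i T) nu = 0) -> dot nu nu = 1 ->
    \tr (invmx (T *m T^T) *m \matrix_(i, j) dot (X i j) nu) = 0) ->
  forall e, \sum_a \sum_i \sum_j
      elliptic_root i a * elliptic_root j a * X i j 0 e =
    \sum_i drift 0 i * T i e.
Proof.
move=> fT Hnu e; set g := T *m T^T.
have gu : g \in unitmx := unitmx_gram fT.
have d0 : \det g != 0 by rewrite -unitfE -unitmxE.
have invE : invmx g = (\det g)^-1 *: gram_adj by rewrite /invmx gu.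
have W0 : gram_trace = (gram_trace *m T^T *m invmx g) *m T.
  apply: row_space_of_normals => // nu nT nu1.
  have := Hnu nu nT nu1; rewrite invE -scalemxAl mxtraceZ => /eqP.
  rewrite mulf_eq0 invr_eq0 (negPf d0) /= => /eqP <-.
  rewrite /gram_trace dot_suml; apply: eq_bigr => i _.
  rewrite dot_suml [RHS]mxE.
  by apply: eq_bigr => j _; rewrite dotZl; congr (_ * _); rewrite [RHS]mxE.
have -> : \sum_i drift 0 i * T i e = (drift *m T) 0 e by rewrite mxE.
have -> : drift = \det g *: (gram_trace *m T^T *m invmx g).
  by rewrite invE -scalemxAr scalerA mulfV // scale1r.
rewrite -scalemxAl -W0 mxE.
have rootE i j : \sum_a elliptic_root i a * elliptic_root j a =
    \det g * gram_adj j i.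
  have -> : \sum_a elliptic_root i a * elliptic_root j a =
      (elliptic_root *m elliptic_root^T) i j.
    by rewrite [RHS]mxE; apply: eq_bigr => a _; congr (_ * _); rewrite [RHS]mxE.
  rewrite /elliptic_root trmx_mul mulmxA -(mulmxA gram_adj) -/g.
  by rewrite /gram_adj mul_adj_mx mul_scalar_mx !mxE.
transitivity (\sum_i \sum_j \det g * gram_adj j i * X i j 0 e).
  rewrite exchange_big; apply: eq_bigr => i _.
  rewrite exchange_big; apply: eq_bigr => j _.
  by rewrite -mulr_suml rootE.
rewrite exchange_big summxE mulr_sumr; apply: eq_bigr => i _.
rewrite summxE mulr_sumr; apply: eq_bigr => j _.
by rewrite -mulrA; congr (_ * _); rewrite [RHS]mxE.
Qed.

End EllipticIdentity.

(** * Continuity of matrix expressions *)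

Section EntrywiseContinuity.
Variables (R : realType) (S : topologicalType) (q : S).

(** Continuity at [q] of all the entries of a matrix depending on a point. *)
Definition mx_cont_at (k m : nat) (A : S -> 'M[R]_(k, m)) : Prop :=
  forall i j, {for q, continuous (fun x => A x i j)}.

Lemma cont_at_sum (I : finType) (f : I -> S -> R) :
  (forall i, {for q, continuous (f i)}) ->
  {for q, continuous (fun x => \sum_i f i x)}.
Proof.
by move=> cf; apply: cvg_big => [|i _]; [exact: add_continuous | exact: cf].
Qed.

Lemma cont_at_prod (I : finType) (f : I -> S -> R) :
  (forall i, {for q, continuous (f i)}) ->
  {for q, continuous (fun x => \prod_i f i x)}.
Proof.
by move=> cf; apply: cvg_big => [|i _]; [exact: mul_continuous | exact: cf].
Qed.

Lemma cont_at_mul (f g : S -> R) : {for q, continuous f} ->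
  {for q, continuous g} -> {for q, continuous (fun x => f x * g x)}.
Proof. by move=> cf cg; exact: cvgM. Qed.

Lemma cont_at_det k (A : S -> 'M[R]_k) : mx_cont_at A ->
  {for q, continuous (fun x => \det (A x))}.
Proof.
move=> cA; rewrite /determinant; apply: cont_at_sum => s.
apply: cont_at_mul; first exact: cvg_cst.
by apply: cont_at_prod => i; exact: cA.
Qed.

Lemma mx_cont_at_adj k (A : S -> 'M[R]_k) : mx_cont_at A ->
  mx_cont_at (fun x => \adj (A x)).
Proof.
move=> cA i j.
have -> : (fun x => (\adj (A x)) i j) = (fun x => cofactor (A x) j i).
  by apply/funext => x; rewrite mxE.
apply: cont_at_mul; first exact: cvg_cst.
apply: cont_at_det => a b.
rewrite (_ : (fun x => _) = (fun x => A x (lift j a) (lift i b))); first exact: cA.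
by apply/funext => x; rewrite !mxE.
Qed.

Lemma mx_cont_at_mul k m l (A : S -> 'M[R]_(k, m)) (B : S -> 'M[R]_(m, l)) :
  mx_cont_at A -> mx_cont_at B -> mx_cont_at (fun x => A x *m B x).
Proof.
move=> cA cB i j.
rewrite (_ : (fun x => _) = (fun x => \sum_a A x i a * B x a j)).
  by apply: cont_at_sum => a; apply: cont_at_mul; [exact: cA | exact: cB].
by apply/funext => x; rewrite mxE.
Qed.

Lemma mx_cont_at_tr k m (A : S -> 'M[R]_(k, m)) :
  mx_cont_at A -> mx_cont_at (fun x => (A x)^T).
Proof.
move=> cA i j; rewrite (_ : (fun x => _) = (fun x => A x j i)); first exact: cA.
by apply/funext => x; rewrite mxE.
Qed.

Section Coefficients.
Variables (k m : nat) (T : S -> 'M[R]_(k, m)) (X : S -> 'I_k -> 'I_k -> 'rV[R]_m).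
Hypothesis cT : mx_cont_at T.
Hypothesis cX : forall i j, mx_cont_at (fun x => X x i j).

Lemma mx_cont_at_gram_adj : mx_cont_at (fun x => gram_adj (T x)).
Proof. by apply/mx_cont_at_adj/mx_cont_at_mul => //; exact: mx_cont_at_tr. Qed.

Lemma mx_cont_at_elliptic_root : mx_cont_at (fun x => elliptic_root (T x)).
Proof. by apply: mx_cont_at_mul => //; exact: mx_cont_at_gram_adj. Qed.

Lemma mx_cont_at_drift : mx_cont_at (fun x => drift (T x) (X x)).
Proof.
apply: mx_cont_at_mul; last exact: mx_cont_at_gram_adj.
apply: mx_cont_at_mul; last exact: mx_cont_at_tr.
move=> a e.
rewrite (_ : (fun x => _) =
  (fun x => \sum_i \sum_j gram_adj (T x) i j * X x j i a e)).
  apply: cont_at_sum => i; apply: cont_at_sum => j.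
  by apply: cont_at_mul; [exact: mx_cont_at_gram_adj | exact: cX].
apply/funext => x; rewrite /gram_trace summxE; apply: eq_bigr => i _.
by rewrite summxE; apply: eq_bigr => j _; rewrite mxE.
Qed.

End Coefficients.
End EntrywiseContinuity.

(** * Functions of several variables along lines *)

Section Lines.
Variables (R : realType) (n : nat).
Implicit Types (u : 'rV[R]_n -> R) (O : set 'rV[R]_n) (q b : 'rV[R]_n).

(** Partial derivative of a scalar function. *)
Definition pd (i : 'I_n) u q : R := 'D_(delta_mx 0 i) u q.

(** Differentiable on [O] with differentiable partial derivatives. *)
Definition twice_diff O u : Prop :=
  forall q, O q -> differentiable u q /\ forall i, differentiable (pd i u) q.

Lemma derive_sum_pd u q b : differentiable u q ->
  'D_b u q = \sum_i b 0 i * pd i u q.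
Proof.
move=> du; rewrite deriveE // [b in LHS]row_sum_delta linear_sum.
by apply: eq_bigr => i _; rewrite linearZ /= /pd deriveE.
Qed.

Lemma is_derive_line u q b t : differentiable u (q + t *: b) ->
  is_derive (t : R) (1 : R) (fun s => u (q + s *: b))
    (\sum_i b 0 i * pd i u (q + t *: b)).
Proof.
move=> du; rewrite -derive_sum_pd //.
have E : (fun h : R => h^-1 *: (((fun s => u (q + s *: b)) \o shift t) (h *: 1)
      - u (q + t *: b))) =
    (fun h => h^-1 *: ((u \o shift (q + t *: b)) (h *: b) - u (q + t *: b))).
  apply/funext => h /=; rewrite [h%:A]mulr1 scalerDl.
  by rewrite [X in u X]addrCA.
have := @diff_derivable _ _ _ u (q + t *: b) b du; rewrite /derivable -E => D.
by split=> //; rewrite /derive E.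
Qed.

Lemma line_cont q b : {for (0 : R), continuous (fun t : R => q + t *: b)}.
Proof.
apply: cvgD; first exact: cvg_cst.
by apply: cvgZr_tmp; exact: cvg_id.
Qed.

Lemma near_line (P : 'rV[R]_n -> Prop) q b : (\forall x \near q, P x) ->
  \forall t \near (0 : R), P (q + t *: b).
Proof.
move=> Pq; apply: (line_cont (q := q) (b := b)).
by rewrite scale0r addr0.
Qed.

(** First and second order conditions at a local maximum, in direction [b], of
    the sum of [u] and of a function that is a polynomial [p] along the line. *)
Lemma max_along_line u O q b (p : {poly R}) : open O -> O q -> twice_diff O u ->
  (\forall t \near (0 : R), u (q + t *: b) + p.[t] <= u q + p.[0]) ->
  \sum_j b 0 j * pd j u q + p^`().[0] = 0 /\
  \sum_j \sum_i b 0 i * b 0 j * pd i (pd j u) q + p^`()^`().[0] <= 0.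
Proof.
move=> oO Oq du umax.
have nO : \forall t \near (0 : R), O (q + t *: b).
  by apply: near_line; exact: open_nbhs_nbhs.
have [|||e1 e2] := @second_derivative_test R (fun t => u (q + t *: b) + p.[t])
    (fun t => \sum_j b 0 j * pd j u (q + t *: b) + p^`().[t])
    (\sum_j \sum_i b 0 i * b 0 j * pd i (pd j u) q + p^`()^`().[0]).
- apply: filterS nO => t Ot.
  by apply: is_deriveD; apply: is_derive_line; have [] := du _ Ot.
- apply: is_deriveD.
  rewrite (_ : (fun t => _) = \sum_(j < n)
      (b 0 j *: (fun t : R => pd j u (q + t *: b)))); last first.
    by apply/funext => t; rewrite fct_sumE.
  apply: is_derive_sum => j.
  rewrite (_ : \sum_i _ = b 0 j *: \sum_i b 0 i * pd i (pd j u) (q + 0 *: b)).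
    apply: is_deriveZ; apply: is_derive_line.
    by rewrite scale0r addr0; apply: (du _ Oq).2.
  rewrite scale0r addr0 [RHS]mulr_sumr; apply: eq_bigr => i _.
  by rewrite mulrCA mulrA.
- by rewrite scale0r addr0.
- by split=> //; move: e1; rewrite scale0r addr0.
Qed.

End Lines.

(** * Hopf's lemma *)

(** Balls are taken for the Euclidean distance, given by its square [dot]; the
    topology is that of the sup norm. *)
Section Balls.
Variables (R : realType) (n : nat).
Implicit Types (q c x : 'rV[R]_n) (r : R).

Lemma coord_dist_cont c q j : {for q, continuous (fun x => (x - c) 0 j)}.
Proof.
rewrite (_ : (fun x => _) = (fun x => x 0 j - c 0 j)); last first.
  by apply/funext => x; rewrite !mxE.
have H : (fun x : 'rV[R]_n => x 0 j) x @[x --> q] --> q 0 j.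
  exact: coord_continuous.
exact: (cvgB H (cvg_cst (c 0 j))).
Qed.

Lemma dot_dist_cont c : continuous (fun q => dot (q - c) (q - c)).
Proof.
move=> q; apply: cont_at_sum => j.
by apply: cont_at_mul; exact: coord_dist_cont.
Qed.

Lemma near_dball q r : 0 < r -> \forall x \near q, dot (x - q) (x - q) < r.
Proof.
move=> r0; apply: cvgr_lt (@dot_dist_cont q q) _ _.
by rewrite subrr dot00.
Qed.

Lemma near_dballP q (P : 'rV[R]_n -> Prop) : (\forall x \near q, P x) ->
  exists2 r, 0 < r & forall x, dot (x - q) (x - q) <= r -> P x.
Proof.
case/nbhs_ballP => e /= e0 He; exists ((e / 2) ^+ 2).
  by rewrite exprn_gt0 // divr_gt0.
move=> x xr; apply: He; split=> // i j; rewrite (ord1 i) /ball /= distrC.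
have := le_trans (sqr_coord_le_dot (x - q) j) xr.
rewrite !mxE ltr_norml => h; set y := x 0 j - q 0 j in h *.
by apply/andP; split; nra.
Qed.

Lemma compact_dball c r (A : set 'rV[R]_n) : closed A ->
  (forall q, A q -> dot (q - c) (q - c) <= r) -> compact A.
Proof.
move=> cA Ar.
have cK : compact [set v : 'rV[R]_n |
    forall i, `[c 0 i - (r + 1), c 0 i + (r + 1)]%classic (v 0 i)].
  apply: (@rV_compact _ _ (fun i => `[c 0 i - (r + 1), c 0 i + (r + 1)]%classic)).
  by move=> i; exact: segment_compact.
apply: subclosed_compact cA cK _ => q /Ar qr i /=.
have r0 : 0 <= r := le_trans (dot_ge0 _) qr.
have := le_trans (sqr_coord_le_dot (q - c) i) qr; rewrite !mxE in_itv /= => h.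
by apply/andP; split; nra.
Qed.

Lemma closed_dball c r : closed [set q | dot (q - c) (q - c) <= r].
Proof.
have H : closed ((fun q => dot (q - c) (q - c)) @^-1` [set y : R | y <= r]).
  by apply: preimage_closed => [q _|]; [exact: dot_dist_cont | exact: closed_le].
exact: H.
Qed.

Lemma closed_dsphere c r : closed [set q | dot (q - c) (q - c) = r].
Proof.
have H : closed ((fun q => dot (q - c) (q - c)) @^-1` [set y : R | y = r]).
  by apply: preimage_closed => [q _|]; [exact: dot_dist_cont | exact: closed_eq].
exact: H.
Qed.

End Balls.

Section Barrier.
Variables (R : realType) (n : nat).
Implicit Types (q b c : 'rV[R]_n) (K r : R).
Let hornersE := (hornerD, hornerN, hornerZ, hornerM, hornerC, hornerX,
  hornerXn, hornerMn).
Let derivsE := (derivD, derivB, derivN, derivZ, derivM, derivC, derivX,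
  derivXn, derivMn, deriv0).

(** The power of the point [q] with respect to the sphere of squared radius [r]
    around [c], with the sign that makes it positive inside. *)
Definition sphere_power c r q : R := r - dot (q - c) (q - c).

(** The barrier [s + K * s ^ 2], where [s] is the power of the point: it vanishes
    on the sphere, is at least [s] inside, and the quadratic term makes its
    image under an elliptic operator positive near the sphere for large [K]. *)
Definition barrier c r K q : R :=
  sphere_power c r q + K * sphere_power c r q ^+ 2.

(** [sphere_power] and [barrier] along the line through [q] in direction [b], as
    polynomials in the parameter. *)
Definition power_line c r q b : {poly R} :=
  (sphere_power c r q)%:P - (2 * dot (q - c) b) *: 'X - dot b b *: 'X^2.

Definition barrier_line c r K q b : {poly R} :=
  power_line c r q b + K *: (power_line c r q b * power_line c r q b).

Lemma barrier_lineE c r K q b t :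
  (barrier_line c r K q b).[t] = barrier c r K (q + t *: b).
Proof.
rewrite /barrier_line /power_line /barrier /sphere_power ?hornersE.
by rewrite addrAC !dotE (dotC c q) (dotC b q) (dotC c b); ring.
Qed.

Lemma deriv_barrier_line c r K q b : (barrier_line c r K q b)^`().[0] =
  - (2 * dot (q - c) b) * (1 + 2 * K * sphere_power c r q).
Proof.
by rewrite /barrier_line /power_line ?derivsE ?hornersE /=; ring.
Qed.

Lemma deriv2_barrier_line c r K q b : (barrier_line c r K q b)^`()^`().[0] =
  - (2 * dot b b) * (1 + 2 * K * sphere_power c r q) +
  8 * K * dot (q - c) b ^+ 2.
Proof.
by rewrite /barrier_line /power_line ?derivsE ?hornersE /=; ring.
Qed.

Lemma barrier_cont c r K : continuous (barrier c r K).
Proof.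
move=> q; have cs : {for q, continuous (sphere_power c r)}.
  exact: (cvgB (cvg_cst r) (@dot_dist_cont R n c q)).
exact: (cvgD cs (cont_at_mul (cvg_cst K) (cont_at_mul cs cs))).
Qed.

End Barrier.

(** Hopf's lemma at a point [q0] of the sphere around [c]: a solution of an
    elliptic equation in the open ball near [q0], which takes at [q0] a value
    [M] strictly larger than all its other values on the closed ball near [q0],
    has a nonzero gradient at [q0]. The second-order coefficients are given by
    the square root [B], and ellipticity is only needed at [q0] in the normal
    direction. *)
Lemma hopf (R : realType) (n m : nat) (u : 'rV[R]_n -> R) (O : set 'rV[R]_n)
    (B : 'rV[R]_n -> 'M[R]_(n, m)) (cf : 'rV[R]_n -> 'rV[R]_n)
    (c q0 : 'rV[R]_n) (M : R) :
  open O -> O q0 -> twice_diff O u -> mx_cont_at q0 B -> mx_cont_at q0 cf ->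
  (forall q, O q -> dot (q - c) (q - c) < dot (q0 - c) (q0 - c) ->
    \sum_a \sum_i \sum_j B q i a * B q j a * pd i (pd j u) q =
    \sum_i cf q 0 i * pd i u q) ->
  (q0 - c) *m B q0 != 0 ->
  (forall q, O q -> dot (q - c) (q - c) <= dot (q0 - c) (q0 - c) ->
    q != q0 -> u q < M) ->
  u q0 = M -> ~ (forall i, pd i u q0 = 0).
Proof.
move=> oO Oq0 du cB ccf eqn nz ult uq0 grad0.
set r := dot (q0 - c) (q0 - c) in eqn ult *.
have r0 : 0 < r.
  by rewrite dot_gt0; apply: contraNneq nz => ->; rewrite mul0mx.
pose Q0 q := - 2 * (\sum_a dot (col a (B q))^T (col a (B q))^T) +
  2 * dot (q - c) (cf q).
pose Q1 q := \sum_a dot (q - c) (col a (B q))^T ^+ 2.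
have colE q a i : (col a (B q))^T 0 i = B q i a by rewrite !mxE.
have cq j := @coord_dist_cont R n c q0 j.
have cQ0 : {for q0, continuous Q0}.
  have c1 : {for q0, continuous
      (fun q => \sum_a dot (col a (B q))^T (col a (B q))^T)}.
    apply: cont_at_sum => a; rewrite (_ : (fun q => _) =
      (fun q => \sum_i B q i a * B q i a)); last first.
      by apply/funext => q; apply: eq_bigr => i _; rewrite !colE.
    by apply: cont_at_sum => i; apply: cont_at_mul; exact: cB.
  have c2 : {for q0, continuous (fun q : 'rV[R]_n => dot (q - c) (cf q))}.
    by apply: cont_at_sum => i; apply: cont_at_mul; [exact: cq | exact: ccf].
  exact: (cvgD (cont_at_mul (cvg_cst _) c1) (cont_at_mul (cvg_cst _) c2)).
have cQ1 : {for q0, continuous Q1}.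
  have c1 a : {for q0, continuous (fun q : 'rV[R]_n => dot (q - c) (col a (B q))^T)}.
    apply: cont_at_sum => i; apply: cont_at_mul; first exact: cq.
    rewrite (_ : (fun q => _) = (fun q => B q i a)); first exact: cB.
    by apply/funext => q; rewrite colE.
  by apply: cont_at_sum => a; exact: (cont_at_mul (c1 a) (c1 a)).
have Q1pos : 0 < Q1 q0.
  have dE a : dot (q0 - c) (col a (B q0))^T = ((q0 - c) *m B q0) 0 a.
    by rewrite [RHS]mxE; apply: eq_bigr => i _; rewrite colE.
  have -> : Q1 q0 = dot ((q0 - c) *m B q0) ((q0 - c) *m B q0).
    by apply: eq_bigr => a _; rewrite dE expr2.
  by rewrite dot_gt0.
(* large enough for the quadratic term to dominate at [q0] *)
pose K := (`|Q0 q0| + 1) / (8 * Q1 q0).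
have K0 : 0 < K by rewrite divr_gt0 ?mulr_gt0 // ltr_pwDr.
pose s := sphere_power c r; pose v := barrier c r K.
pose E q := (1 + 2 * K * s q) * Q0 q + 8 * K * Q1 q.
have sq0 : s q0 = 0 by rewrite /s /sphere_power subrr.
have Epos : 0 < E q0.
  have -> : E q0 = Q0 q0 + (`|Q0 q0| + 1).
    by rewrite /E sq0 mulr0 addr0 mul1r /K; field; rewrite gt_eqF.
  have := ler_norm (- Q0 q0); rewrite normrN; lra.
have cE : {for q0, continuous E}.
  have cs : {for q0, continuous s}.
    exact: (cvgB (cvg_cst r) (@dot_dist_cont R n c q0)).
  exact: (cvgD (cont_at_mul (cvgD (cvg_cst _) (cont_at_mul (cvg_cst _) cs)) cQ0)
    (cont_at_mul (cvg_cst _) cQ1)).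
have [d d0 Hd] : exists2 d, 0 < d &
    forall x, dot (x - q0) (x - q0) <= d -> O x /\ 0 < E x.
  apply: near_dballP; apply: filterI; first exact: open_nbhs_nbhs.
  exact: cvgr_gt cE _ Epos.
(* the barrier is a strict subsolution on the lens [D]; the part [S] of its
   boundary lies away from [q0], where [u] stays below [M] *)
pose D := [set q | dot (q - c) (q - c) <= r] `&`
  [set q | dot (q - q0) (q - q0) <= d].
pose S := [set q | dot (q - c) (q - c) <= r] `&`
  [set q | dot (q - q0) (q - q0) = d].
have cD : compact D.
  apply: (@compact_dball _ _ c r) => [|q []//].
  by apply: closedI; exact: closed_dball.
have cS : compact S.
  apply: (@compact_dball _ _ c r) => [|q []//].
  by apply: closedI; [exact: closed_dball | exact: closed_dsphere].
have ucont q : O q -> {for q, continuous u}.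
  by move=> /du[] /differentiable_continuous.
have s_le q : s q <= r by rewrite /s /sphere_power gerBl dot_ge0.
have v_le q : D q -> v q <= r + K * r ^+ 2.
  move=> [/= qc _]; have : 0 <= s q by rewrite /s /sphere_power subr_ge0.
  rewrite /v /barrier -/(s q); have := s_le q => h1 h2.
  by rewrite lerD // ler_pM2l // ler_sqr ?nnegrE // ltW.
pose V := r + K * r ^+ 2.
have V0 : 0 < V by rewrite addr_gt0 // mulr_gt0 // exprn_gt0.
have [eps eps0 Heps] : exists2 eps, 0 < eps &
    forall q, S q -> u q + eps * v q <= M.
  have [S0|/nonemptyPn S0] := pselect (S !=set0); last first.
    by exists 1 => // q; rewrite S0.
  have [q1 /set_mem q1S q1max] : exists2 q1, q1 \in S &
      forall q, q \in S -> u q <= u q1.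
    apply: compact_EVT_max => //; apply: continuous_in_subspaceT => q.
    by rewrite inE => -[_ /= qd]; apply: ucont; apply: (Hd _ _).1; rewrite qd.
  have uq1 : u q1 < M.
    case: (q1S) => /= h1 h2; apply: ult => //.
      by apply: (Hd _ _).1; rewrite h2.
    by apply: contraTneq d0 => q10; rewrite -h2 q10 subrr dot00 ltxx.
  exists ((M - u q1) / V); first by rewrite divr_gt0 // subr_gt0.
  move=> q qS; have qD : D q by case: qS => /= h1 h2; split=> //=; rewrite h2.
  have h : (M - u q1) / V * v q <= M - u q1.
    by rewrite -mulrA ger_pMr ?subr_gt0 // mulrC ler_pdivrMr // mul1r v_le.
  have := q1max q (mem_set qS); lra.
pose f q := u q + eps * v q.
have q0D : D q0.
  by split=> //=; rewrite subrr dot00 ltW.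
(* an interior maximum of [f] above [M] would contradict the equation *)
have fle q : D q -> f q <= M.
  have [q1 /set_mem q1D q1max] : exists2 q1, q1 \in D &
      forall q, q \in D -> f q <= f q1.
    apply: compact_EVT_max => //; first by exists q0.
    apply: continuous_in_subspaceT => x; rewrite inE => -[_ /= /Hd[Ox _]].
    have H := cvgD (ucont _ Ox)
      (cont_at_mul (cvg_cst eps) (@barrier_cont R n c r K x)).
    exact: H.
  move=> qD; apply: le_trans (q1max _ (mem_set qD)) _.
  rewrite leNgt; apply/negP => fM.
  case: (q1D) => /= q1c q1d; have [Oq1 Eq1] := Hd _ q1d.
  have {}q1c : dot (q1 - c) (q1 - c) < r.
    rewrite lt_neqAle q1c andbT; apply: contraTneq fM => q1r.
    rewrite -leNgt /f /v /barrier /sphere_power q1r subrr expr0n.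
    rewrite mulr0 addr0 mulr0 addr0.
    have [->|q10] := eqVneq q1 q0; first by rewrite uq0.
    by apply: ltW; apply: ult => //; rewrite q1r.
  have {}q1d : dot (q1 - q0) (q1 - q0) < d.
    rewrite lt_neqAle q1d andbT; apply: contraTneq fM => q1r.
    by rewrite -leNgt; apply: Heps; split=> //=; exact: ltW.
  have near1 : \forall x \near q1, f x <= f q1.
    have n1 : \forall x \near q1, dot (x - c) (x - c) < r.
      exact: cvgr_lt (@dot_dist_cont R n c q1) _ q1c.
    have n2 : \forall x \near q1, dot (x - q0) (x - q0) < d.
      exact: cvgr_lt (@dot_dist_cont R n q0 q1) _ q1d.
    apply: filterS2 n1 n2 => x x1 x2.
    by apply: q1max; apply: mem_set; split; exact: ltW.
  have dir b := @max_along_line R n u O q1 b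
    (eps *: barrier_line c r K q1 b) oO Oq1 du.
  have {}dir (b : 'rV[R]_n) : \sum_j b 0 j * pd j u q1 =
        eps * (2 * dot (q1 - c) b * (1 + 2 * K * s q1)) /\
      \sum_i \sum_j b 0 i * b 0 j * pd i (pd j u) q1 +
        eps * (- (2 * dot b b) * (1 + 2 * K * s q1) +
          8 * K * dot (q1 - c) b ^+ 2) <= 0.
    have [|e1 e2] := dir b.
      have := near_line b near1; apply: filterS => t.
      by rewrite !hornerZ !barrier_lineE scale0r addr0.
    split.
      move: e1; rewrite derivZ hornerZ deriv_barrier_line -/(s q1).
      by move/eqP; rewrite addr_eq0 => /eqP ->; ring.
    rewrite exchange_big /=.
    by move: e2; rewrite !derivZ hornerZ deriv2_barrier_line -/(s q1); apply.
  have : \sum_a (\sum_i \sum_j B q1 i a * B q1 j a * pd i (pd j u) q1 +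
      eps * (- (2 * dot (col a (B q1))^T (col a (B q1))^T) *
        (1 + 2 * K * s q1) + 8 * K * dot (q1 - c) (col a (B q1))^T ^+ 2)) <= 0.
    apply: sumr_le0 => a _; have [_] := dir (col a (B q1))^T.
    by under eq_bigr do under eq_bigr do rewrite !colE.
  rewrite big_split /= eqn // (dir (cf q1)).1 -mulr_sumr -mulrDr.
  rewrite pmulr_rle0 // big_split /= -mulr_suml -mulr_sumr leNgt => /negP; apply.
  by move: Eq1; rewrite /E /Q0 /Q1 sumrN -mulr_sumr; congr (_ < _); ring.
(* compare [u] with the barrier along the inner normal at [q0] *)
pose p : {poly R} := (eps * r) *: (2 *: 'X - 'X^2).
have : \sum_i (c - q0) 0 i * pd i u (q0 + 0 *: (c - q0)) + p^`().[0] <= 0.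
  apply: (@is_derive_right_le R (fun t => u (q0 + t *: (c - q0)) + p.[t])).
    apply: is_deriveD; apply: is_derive_line.
    by rewrite scale0r addr0; case: (du _ Oq0).
  have n1 : \forall t \near (0 : R), dot (q0 + t *: (c - q0) - q0)
      (q0 + t *: (c - q0) - q0) < d.
    exact: (near_line _ (near_dball q0 d0)).
  have n2 : \forall t \near (0 : R), t < 1.
    exact: (@cvgr_lt R _ (nbhs (0 : R)) _ id 0 cvg_id 1 ltr01).
  apply: filterS2 n1 n2 => t td t1 t0.
  have pw : dot (q0 + t *: (c - q0) - c) (q0 + t *: (c - q0) - c) =
      (1 - t) ^+ 2 * r.
    rewrite (_ : q0 + t *: (c - q0) - c = (1 - t) *: (q0 - c)).
      by rewrite dotZl dotZr mulrA -expr2.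
    by apply/rowP => j; rewrite !mxE; ring.
  have tD : D (q0 + t *: (c - q0)).
    split=> /=; last exact: ltW.
    by rewrite pw ger_pMl // expr_le1 //; lra.
  rewrite scale0r addr0 uq0 /p !hornerZ !hornerD !hornerN !hornerZ.
  rewrite !hornerX !hornerXn.
  rewrite mulr0 expr0n subr0 mulr0 addr0.
  apply: le_trans (fle _ tD); rewrite /f lerD2l -mulrA ler_pM2l //.
  rewrite /v /barrier; have -> : sphere_power c r (q0 + t *: (c - q0)) =
      r * (2 * t - t ^+ 2) by rewrite /sphere_power pw; ring.
  by rewrite lerDl mulr_ge0 ?sqr_ge0 // ltW.
rewrite big1 => [|i _]; last by rewrite scale0r addr0 grad0 mulr0.
have -> : p^`().[0] = 2 * eps * r.
  rewrite /p derivZ derivB derivZ derivX derivXn.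
  by rewrite !(hornerZ, hornerD, hornerN, hornerMn, hornerC, hornerXn) /=; ring.
by rewrite add0r leNgt !mulr_gt0.
Qed.

(** * The strong maximum principle up to the boundary *)

Section ConnectedLevel.
Variables (R : realType) (T : topologicalType).

Lemma closed_level (A : set T) (f : T -> R) c : closed A ->
  (forall t, A t -> {for t, continuous f}) ->
  closed (A `&` [set t | f t = c]).
Proof.
move=> cA cf t tc.
have At : A t by apply: cA; apply: closureS tc => x [].
split=> //=; apply: contrapT => /eqP ftc.
have d0 : 0 < `|f t - c| by rewrite normr_gt0 subr_eq0.
have : \forall s \near t, `|f t - f s| < `|f t - c|.
  have /cvgrPdist_lt := cf t At; exact.
by move=> /tc[s [[_ /= ->]]]; rewrite ltxx.
Qed.

(** On a connected set, a level set that is open relative to the set and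
    contains one of its points contains all of it. *)
Lemma connected_level (A : set T) (f : T -> R) c : connected A -> closed A ->
  (forall t, A t -> {for t, continuous f}) ->
  (forall t, A t -> f t = c -> \forall s \near t, A s -> f s = c) ->
  forall x y, A x -> A y -> f x = c -> f y = c.
Proof.
move=> cnA clA cf lc x y Ax Ay fx.
have E : A `&` [set t | f t = c] = A.
  apply: cnA; first by exists x.
    exists (interior [set t | A t -> f t = c]); first exact: open_interior.
    apply/seteqP; split=> t [At /= ft]; split=> //=; first exact: lc.
    exact: (nbhs_singleton ft).
  exists (A `&` [set t | f t = c]); first exact: closed_level.
  by rewrite setIA setIid.
by have [] : (A `&` [set t | f t = c]) y by rewrite E.
Qed.

End ConnectedLevel.

Lemma convex_gt0 (R : realType) (a b t : R) : 0 <= t -> t <= 1 -> 0 < a ->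
  0 < b -> 0 < a + t * (b - a).
Proof. by move=> t0 t1 a0 b0; case: (lerP a b) => h; nra. Qed.

(** The elliptic equation holds on the part of [O] in the half-space, where [M]
    is an upper bound; the boundary condition enters only through the
    assumption that the gradient vanishes wherever [M] is attained. *)
Section StrongMaximum.
Variables (R : realType) (n m : nat) (i0 : 'I_n) (i0E : i0 = 0%N :> nat).
Variables (u : 'rV[R]_n -> R) (O : set 'rV[R]_n).
Variables (B : 'rV[R]_n -> 'M[R]_(n, m)) (cf : 'rV[R]_n -> 'rV[R]_n) (M : R).
Notation H := (@halfspace R n).
Hypothesis openO : open O.
Hypothesis du : twice_diff O u.
Hypothesis cB : forall q, O q -> mx_cont_at q B.
Hypothesis ccf : forall q, O q -> mx_cont_at q cf.
Hypothesis Bfree : forall q, O q -> H q -> forall v : 'rV[R]_n,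
  v *m B q = 0 -> v = 0.
Hypothesis eqn : forall q, O q -> H q ->
  \sum_a \sum_i \sum_j B q i a * B q j a * pd i (pd j u) q =
  \sum_i cf q 0 i * pd i u q.
Hypothesis uM : forall q, O q -> H q -> u q <= M.
Hypothesis grad0 : forall q, O q -> H q -> u q = M -> forall i, pd i u q = 0.

Lemma halfspaceE q : H q <-> 0 <= q 0 i0.
Proof.
split=> [|h j j0]; first exact.
by rewrite (_ : j = i0) //; apply/val_inj; rewrite /= j0 i0E.
Qed.

Lemma u_cont q : O q -> {for q, continuous u}.
Proof. by move=> /du[] /differentiable_continuous. Qed.

Lemma near_pos (q : 'rV[R]_n) : 0 < q 0 i0 ->
  \forall x \near q, 0 < (x : 'rV[R]_n) 0 i0.
Proof.
move=> q0.
have h : (fun x : 'rV[R]_n => x 0 i0) x @[x --> q] --> q 0 i0.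
  exact: coord_continuous.
exact: cvgr_gt h _ q0.
Qed.

(** At an interior point, by Hopf's lemma for a ball whose boundary contains
    the point of the level set closest to a point outside of it. *)
Lemma strong_max_interior q0 : O q0 -> 0 < q0 0 i0 -> u q0 = M ->
  \forall q \near q0, u q = M.
Proof.
move=> Oq0 q0pos uq0.
have [r r0 Hr] : exists2 r, 0 < r &
    forall x, dot (x - q0) (x - q0) <= r -> O x /\ 0 < x 0 i0.
  apply: near_dballP; apply: filterI; last exact: near_pos.
  exact: open_nbhs_nbhs.
have r4 : 0 < r / 4 by rewrite divr_gt0.
apply: filterS (near_dball q0 r4) => q1 q1r; apply: contrapT => /eqP uq1.
pose d := dot (q1 - q0) (q1 - q0).
have dE : dot (q0 - q1) (q0 - q1) = d by rewrite /d -opprB dotNl dotNr opprK.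
have sub x : dot (x - q1) (x - q1) <= d -> O x /\ 0 < x 0 i0.
  move=> xd; apply: Hr.
  have -> : x - q0 = (x - q1) + (q1 - q0) by rewrite addrA subrK.
  have := dot_add_le (x - q1) (q1 - q0); rewrite -/d; move: q1r; rewrite -/d; lra.
pose Z := [set x | dot (x - q1) (x - q1) <= d] `&` [set x | u x = M].
have cZ : compact Z.
  apply: (@compact_dball _ _ q1 d) => [|x []//].
  have H := @closed_level R _ _ u M (@closed_dball R n q1 d).
  by apply: H => x /= /sub[Ox _]; exact: u_cont.
have [q2 /set_mem q2Z q2min] : exists2 q2, q2 \in Z &
    forall x, x \in Z -> dot (q2 - q1) (q2 - q1) <= dot (x - q1) (x - q1).
  apply: compact_EVT_min => //; first by exists q0; split=> //=; rewrite dE.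
  by apply: continuous_in_subspaceT => x _; exact: dot_dist_cont.
case: q2Z => /= q2d uq2; have [Oq2 q2pos] := sub _ q2d.
have Hpos (x : 'rV[R]_n) : 0 < x 0 i0 -> H x by move=> x0; apply/halfspaceE/ltW.
pose c := 2^-1 *: (q1 + q2).
apply: (@hopf R n m u O B cf c q2 M) => //; last by apply: grad0 => //; exact: Hpos.
- exact: cB.
- exact: ccf.
- move=> q Oq qc; apply: eqn => //; apply: Hpos.
  have qq2 : q != q2 by apply: contraTneq qc => ->; rewrite ltxx.
  have := inner_ball_lt (ltW qc) qq2 => /ltW /le_trans /(_ q2d).
  by case/sub.
- apply/eqP => /(Bfree Oq2 (Hpos _ q2pos)) /eqP.
  rewrite subr_eq0 => /eqP q2c; move: uq1; rewrite (_ : q1 = q2) ?uq2 ?eqxx //.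
  apply/rowP => j; move/rowP/(_ j): q2c; rewrite /c !mxE; lra.
- move=> q Oq qc qq2; have ql := inner_ball_lt qc qq2.
  have [_ qpos] := sub _ (le_trans (ltW ql) q2d).
  rewrite lt_neqAle uM ?andbT //; last exact: Hpos.
  apply/eqP => uq; suff /q2min : q \in Z by rewrite leNgt ql.
  by apply: mem_set; split=> //=; exact: le_trans (ltW ql) q2d.
Qed.

(** At a boundary point, either the maximum is attained at interior points
    nearby, and spreads along segments, or Hopf's lemma applies to a ball inside
    the half-space whose boundary contains the point. *)
Lemma strong_max q0 : O q0 -> H q0 -> u q0 = M ->
  \forall q \near q0, H q -> u q = M.
Proof.
move=> Oq0 Hq0 uq0.
have [r r0 Hr] : exists2 r, 0 < r & forall x, dot (x - q0) (x - q0) <= r -> O x.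
  by apply: near_dballP; exact: open_nbhs_nbhs.
have [[q3 [q3r q3pos uq3]]|noint] := pselect (exists q3 : 'rV[R]_n,
    [/\ dot (q3 - q0) (q3 - q0) < r, 0 < q3 0 i0 & u q3 = M]).
  have all1 (q1 : 'rV[R]_n) : dot (q1 - q0) (q1 - q0) < r -> 0 < q1 0 i0 -> u q1 = M.
    move=> q1r q1pos.
    pose g (t : R) := q3 + t *: (q1 - q3).
    have gin t : t \in `[0, 1]%R ->
        dot (g t - q0) (g t - q0) < r /\ 0 < g t 0 i0.
      rewrite in_itv /= => /andP[t0 t1]; split; last first.
        by rewrite /g !mxE; exact: convex_gt0.
      have -> : g t - q0 = (1 - t) *: (q3 - q0) + t *: (q1 - q0).
        by apply/rowP => j; rewrite !mxE; ring.
      apply: le_lt_trans (dot_convex _ _ t0 t1) _.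
      move: q3r q1r; rewrite -subr_gt0 => h3; rewrite -subr_gt0 => h1.
      by have := convex_gt0 t0 t1 h3 h1; lra.
    have gc t : {for t, continuous g}.
      have cs : {for t, continuous (fun s : R => s *: (q1 - q3))}.
        by apply: cvgZr_tmp; exact: cvg_id.
      exact: (cvgD (cvg_cst q3) cs).
    have gO t : t \in `[0, 1]%R -> O (g t).
      by move=> /gin[/ltW /Hr].
    have E0 : q3 = g 0 by rewrite /g scale0r addr0.
    have E1 : q1 = g 1 by rewrite /g scale1r addrC subrK.
    rewrite E1; apply: (@connected_level R R `[0, 1]%classic (u \o g) M
      (@segment_connected R 0 1) _ _ _ 0 1) => //=.
    + exact: interval_closed.
    + move=> t tI; have Ot := gO t tI.
      by apply: continuous_comp; [exact: gc | exact: u_cont].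
    + move=> t tI ut; have [_ tpos] := gin t tI.
      have : \forall s \near t, u (g s) = M.
        by have := strong_max_interior (gO t tI) tpos ut => /(gc t).
      by apply: filterS => s us _.
    + by rewrite in_itv /= lexx ler01.
    + by rewrite in_itv /= lexx ler01.
    + by rewrite -E0.
  apply: filterS (near_dball q0 r0) => q qr Hq.
  have Oq : O q by apply: Hr; exact: ltW.
  apply/eqP; rewrite eq_le uM //= leNgt; apply/negP => uqM.
  have n1 : \forall x \near q, u x < M by exact: cvgr_lt (u_cont Oq) _ uqM.
  have n2 : \forall x \near q, dot (x - q0) (x - q0) < r.
    exact: cvgr_lt (@dot_dist_cont R n q0 q) _ qr.
  have [e e0 He] := nbhs0_itv (near_line (delta_mx 0 i0) (filterI n1 n2)).
  have [] := He (e / 2) _; first by rewrite gtr0_norm; lra.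
  move=> h1 h2; move: h1; rewrite all1 ?ltxx // !mxE !eqxx mulr1.
  by move/halfspaceE: Hq => h; lra.
have q00 : q0 0 i0 = 0.
  apply/eqP; rewrite eq_le (halfspaceE q0).1 // andbT leNgt; apply/negP => q0pos.
  by apply: noint; exists q0; split=> //; rewrite subrr dot00.
(* the ball of radius [th] in the half-space, with [q0] on its boundary *)
exfalso; pose th := Num.min 1 r / 4.
have th0 : 0 < th by rewrite divr_gt0 // lt_min ltr01 r0.
have th1 : th <= 4^-1 /\ th <= r / 4.
  have m1 : Num.min 1 r <= 1 by rewrite ge_min lexx.
  have m2 : Num.min 1 r <= r by rewrite ge_min lexx orbT.
  by rewrite /th; split; lra.
pose c := q0 + th *: delta_mx 0 i0.
have cE (x : 'rV[R]_n) : dot (x - c) (x - c) =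
    dot (x - q0) (x - q0) - 2 * th * (x 0 i0) + th ^+ 2.
  have -> : x - c = (x - q0) - th *: delta_mx 0 i0 by rewrite /c opprD addrA.
  rewrite !dotE !dot_delta !dot_deltal !mxE q00 !eqxx /= mulr1n; ring.
have rE : dot (q0 - c) (q0 - c) = th ^+ 2.
  by rewrite cE subrr dot00 q00 mulr0 subr0 add0r.
have inb (x : 'rV[R]_n) : dot (x - c) (x - c) <= dot (q0 - c) (q0 - c) -> x != q0 ->
    dot (x - q0) (x - q0) < r /\ 0 < x 0 i0.
  rewrite rE cE => h xq.
  have p : 0 < dot (x - q0) (x - q0) by rewrite dot_gt0 subr_eq0.
  have x0 : 0 < x 0 i0 by nra.
  split=> //.
  have := sqr_coord_le_dot (x - q0) i0; rewrite !mxE q00 subr0 => h2.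
  have x2 : x 0 i0 <= 2 * th by nra.
  by case: th1 => h3 h4; nra.
apply: (@hopf R n m u O B cf c q0 M) => //; last exact: grad0.
- exact: cB.
- exact: ccf.
- move=> q Oq qc; apply: eqn => //.
  have qq : q != q0 by apply: contraTneq qc => ->; rewrite ltxx.
  by have [_ ?] := inb _ (ltW qc) qq; apply/halfspaceE/ltW.
- apply/eqP => /(Bfree Oq0 Hq0) h; move: rE.
  by rewrite h dot00 => /esym/eqP; rewrite sqrf_eq0 gt_eqF.
- move=> q Oq qc qq; have [qr qpos] := inb _ qc qq.
  rewrite lt_neqAle uM ?andbT //; last by apply/halfspaceE/ltW.
  by apply/eqP => uq; apply: noint; exists q.
Qed.

End StrongMaximum.

(** * Charts and their smooth extensions *)

Lemma near_eq_differentiable (R : realType) (V W : normedModType R)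
    (f g : V -> W) (x : V) :
  {near x, f =1 g} -> differentiable f x -> differentiable g x.
Proof.
move=> fg /diffP[dc de]; have fgx := nbhs_singleton fg; apply/diffP => /=.
apply: (@getPex _ (fun (df : {linear V -> W}) => continuous df /\
  forall y, g y = g (lim (nbhs x)) + df (y - lim (nbhs x))
                  +o_(y \near x) (y - lim (nbhs x)))).
exists ('d f x); split=> //.
have {de} : f = cst (f (lim (nbhs x))) + 'd f x \o center (lim (nbhs x))
    +o_ (nbhs x) (center (lim (nbhs x))) by rewrite funeqE.
move/eqaddoP => de.
suff : g = cst (g (lim (nbhs x))) + 'd f x \o center (lim (nbhs x))
    +o_ (nbhs x) (center (lim (nbhs x))) by rewrite funeqE.
apply/eqaddoP => e e0; apply: filterS2 (de e e0) fg => y.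
rewrite !lim_id // !fctE /= => + E.
by rewrite E fgx.
Qed.

Section Smooth.
Variables (R : realType) (n m : nat).
Implicit Types (O U : set 'rV[R]_n) (G X : 'rV[R]_n -> 'rV[R]_m).
Notation H := (@halfspace R n).

Lemma Ck_sub k U O G : O `<=` U -> Ck k U G -> Ck k O G.
Proof.
move=> OU; elim: k G => [|k IH] G /=; first by move=> h q /OU /h.
by move=> [h1 h2]; split=> [q /OU /h1 //|i]; exact: IH.
Qed.

Lemma pd_coord G i e q : differentiable G q ->
  pd i (fun x => G x 0 e) q = ('D_(delta_mx 0 i) G q) 0 e.
Proof. by move=> dG; rewrite derive_mx ?mxE //; exact: diff_derivable. Qed.

Lemma differentiable_entry G e q : differentiable G q ->
  differentiable (fun x => G x 0 e) q.
Proof.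
move=> dG; apply: (@differentiable_comp _ _ _ _ G (fun N : 'rV[R]_m => N 0 e)).
  exact: dG.
exact: differentiable_coord.
Qed.

Lemma differentiable_cont_entry G q : differentiable G q -> mx_cont_at q G.
Proof.
move=> dG i e; rewrite (ord1 i).
exact: differentiable_continuous (differentiable_entry e dG).
Qed.

Lemma pd_scale (a : R) (f : 'rV[R]_n -> R) i q : differentiable f q ->
  pd i (a *: f) q = a * pd i f q.
Proof. by move=> df; rewrite /pd deriveZ //; exact: diff_derivable. Qed.

Section OnOpen.
Variables (O : set 'rV[R]_n) (G : 'rV[R]_n -> 'rV[R]_m).
Hypothesis oO : open O.
Hypothesis sG : smooth_on O G.

Lemma smooth_diff q : O q -> differentiable G q.
Proof. by case: (sG 1) => h _; exact: h. Qed.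

Lemma smooth_diff1 i q : O q -> differentiable ('D_(delta_mx 0 i) G) q.
Proof. by case: (sG 2) => _ /(_ i)[h _]; exact: h. Qed.

Lemma smooth_diff2 i j q : O q ->
  differentiable ('D_(delta_mx 0 i) ('D_(delta_mx 0 j) G)) q.
Proof. by case: (sG 3) => _ /(_ j)[_ /(_ i)[h _]]; exact: h. Qed.

Lemma near_pd_coord (a : R) i e q : O q -> \forall x \near q,
  a * ('D_(delta_mx 0 i) G x) 0 e = pd i (a *: (fun y => G y 0 e)) x.
Proof.
move=> Oq; have : \forall x \near q, O x by exact: open_nbhs_nbhs.
apply: filterS => x Ox; rewrite pd_scale; last first.
  exact: differentiable_entry (smooth_diff Ox).
by rewrite pd_coord //; exact: smooth_diff.
Qed.

Lemma twice_diff_coord (a : R) e : twice_diff O (a *: (fun x => G x 0 e)).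
Proof.
move=> q Oq; split.
  by apply: differentiableZ; apply: differentiable_entry; exact: smooth_diff.
move=> i; apply: near_eq_differentiable (near_pd_coord a i e Oq) _.
apply: (differentiableZ (f := fun x => ('D_(delta_mx 0 i) G x) 0 e)).
exact: differentiable_entry (smooth_diff1 i Oq).
Qed.

Lemma pd_coord1 (a : R) e i q : O q ->
  pd i (a *: (fun x => G x 0 e)) q = a * ('D_(delta_mx 0 i) G q) 0 e.
Proof. by move=> /(near_pd_coord a i e)/nbhs_singleton. Qed.

Lemma pd_coord2 (a : R) e i j q : O q ->
  pd i (pd j (a *: (fun x => G x 0 e))) q =
  a * ('D_(delta_mx 0 i) ('D_(delta_mx 0 j) G) q) 0 e.
Proof.
move=> Oq; rewrite -pd_coord; last exact: smooth_diff1.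
rewrite -pd_scale; last exact: differentiable_entry (smooth_diff1 j Oq).
by apply/esym/near_eq_derive; exact: near_pd_coord.
Qed.

End OnOpen.

Lemma halfspace_shift q i h : H q -> 0 <= h -> H (q + h *: delta_mx 0 i).
Proof.
move=> Hq h0 j j0; rewrite !mxE eqxx /=.
by rewrite addr_ge0 ?Hq // mulr_ge0 // ler0n.
Qed.

(** The one-sided partial derivatives are those of any smooth extension. *)
Lemma hpartialE O G X i q : open O -> O q -> H q ->
  (forall y, O y -> H y -> X y = G y) -> differentiable G q ->
  hpartial i X q = 'D_(delta_mx 0 i) G q.
Proof.
move=> oO Oq Hq XG dG; set b := delta_mx 0 i.
have FF : ProperFilter (within [set h : R | H (q + h *: b)] (0 : R)^').
  apply: Build_ProperFilter_ex => P; case/nbhs_ballP => e /= e0 He.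
  exists (e / 2); apply: (He (e / 2)).
  - rewrite -ball_normE /= sub0r normrN gtr0_norm ?divr_gt0 //; lra.
  - by rewrite gt_eqF // divr_gt0.
  - by apply: halfspace_shift => //; rewrite divr_ge0 // ltW.
have D : (fun h : R => h^-1 *: ((G \o shift q) (h *: b) - G q)) @ (0 : R)^'
    --> 'D_b G q by exact: diff_derivable.
have {}D : (fun h : R => h^-1 *: ((G \o shift q) (h *: b) - G q)) @
    within [set h : R | H (q + h *: b)] (0 : R)^' --> 'D_b G q.
  by apply: cvg_trans D; apply: cvg_app; exact: cvg_within.
apply: cvg_lim => //; apply: cvg_trans D.
apply: near_eq_cvg; rewrite near_withinE.
have nO : \forall h \near (0 : R), O (q + h *: b).
  by apply: near_line; exact: open_nbhs_nbhs.
apply: cvg_within; move: nO; apply: filterS => h Oh Hh /=.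
by rewrite [h *: b + q]addrC -!XG.
Qed.

End Smooth.

(** * Minimal immersions in a chart *)

Section ChartLocal.
Variables (R : realType) (n : nat) (M : topologicalType).
Variables (c : chart R M n) (X : 'rV[R]_n -> 'rV[R]_(n + 1)).
Notation H := (@halfspace R n).

(** [G] is a smooth extension to the open set [O] of the parametrization [X],
    and [O] meets the half-space inside the image of the chart. *)
Record local_ext (O : set 'rV[R]_n) (G : 'rV[R]_n -> 'rV[R]_(n + 1)) : Prop :=
  LocalExt {
    ext_open : open O ;
    ext_smooth : smooth_on O G ;
    ext_cod : forall y, O y -> H y -> chart_cod c y ;
    ext_eq : forall y, O y -> H y -> X y = G y }.

Lemma local_extP q : is_chart c -> smooth_within (chart_cod c) X ->
  chart_cod c q -> H q /\ exists O G, local_ext O G /\ O q.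
Proof.
move=> ic sX cq; have [U1 oU1 E] := chart_cod_open ic.
have [U1q Hq] : (U1 `&` H) q by rewrite -E.
split=> //; have [U2 [G [oU2 U2q sG GX]]] := sX q cq.
exists (U1 `&` U2), G; split; last by [].
split; first exact: openI.
- by move=> k; apply: Ck_sub (sG k) => y [].
- by move=> y [h1 _] h2; rewrite E.
- by move=> y [h1 h2] h3; rewrite GX // E.
Qed.

Variables (O : set 'rV[R]_n) (G : 'rV[R]_n -> 'rV[R]_(n + 1)).
Hypothesis ext : local_ext O G.

Let oO := ext_open ext.
Let sG := ext_smooth ext.

Lemma hpartial_ext i q : O q -> H q -> hpartial i X q = 'D_(delta_mx 0 i) G q.
Proof.
move=> Oq Hq; apply: (@hpartialE R n (n + 1) O G X i q) => //.
  exact: (ext_eq ext).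
exact: (smooth_diff sG Oq).
Qed.

Lemma hpartial2_ext i j q : O q -> H q ->
  hpartial i (hpartial j X) q = 'D_(delta_mx 0 i) ('D_(delta_mx 0 j) G) q.
Proof.
move=> Oq Hq; apply: (@hpartialE R n (n + 1) O _ _ i q) => // [y Oy Hy|].
  exact: hpartial_ext.
exact: (smooth_diff1 sG j Oq).
Qed.

(** First and second derivatives of the extension; on the half-space they are
    those of the parametrization. *)
Definition ext_tangent (q : 'rV[R]_n) : 'M[R]_(n, n + 1) :=
  \matrix_(i < n) 'D_(delta_mx 0 i) G q.

Definition ext_second (q : 'rV[R]_n) (i j : 'I_n) : 'rV[R]_(n + 1) :=
  'D_(delta_mx 0 i) ('D_(delta_mx 0 j) G) q.

Lemma tangent_mx_ext q : O q -> H q -> tangent_mx X q = ext_tangent q.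
Proof. by move=> Oq Hq; apply/row_matrixP => i; rewrite !rowK hpartial_ext. Qed.

Lemma ext_val q : O q -> H q -> G q = X q.
Proof. by move=> Oq Hq; rewrite (ext_eq ext). Qed.

Lemma near_ext_line q i : O q ->
  \forall t \near (0 : R), O (q + t *: delta_mx 0 i).
Proof. by move=> Oq; apply: near_line; exact: open_nbhs_nbhs. Qed.

Lemma is_derive_ext_entry q : O q -> forall i e,
  is_derive (0 : R) (1 : R) (fun t => G (q + t *: delta_mx 0 i) 0 e)
    (ext_tangent q i e).
Proof.
move=> Oq i e; have dG : differentiable G (q + 0 *: delta_mx 0 i).
  by rewrite scale0r addr0; exact: (smooth_diff sG Oq).
apply: is_derive_eq (is_derive_line (differentiable_entry e dG)) _.
rewrite -derive_sum_pd; last exact: differentiable_entry.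
rewrite scale0r addr0 in dG *.
by rewrite [in RHS]mxE -pd_coord.
Qed.

Lemma is_derive_ext_dist q : O q -> H q -> forall (v : 'rV[R]_n) i,
  is_derive (0 : R) (1 : R)
    (fun t => dot (xpart (G (q + t *: delta_mx 0 i)) - v)
        (xpart (G (q + t *: delta_mx 0 i)) - v))
    (2 * dot (xpart (row i (ext_tangent q))) (xpart (X q) - v)).
Proof.
move=> Oq Hq v i; pose g j := fun t : R =>
  G (q + t *: delta_mx 0 i) 0 (lshift 1 j) - v 0 j.
have dg j : is_derive (0 : R) (1 : R) (g j) (ext_tangent q i (lshift 1 j) - 0).
  apply: is_deriveB; exact: is_derive_ext_entry.
have D : is_derive (0 : R) (1 : R) (\sum_(j < n) (g j * g j))
    (\sum_(j < n) (g j 0 *: (ext_tangent q i (lshift 1 j) - 0) +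
       g j 0 *: (ext_tangent q i (lshift 1 j) - 0))).
  by apply: is_derive_sum => j; exact: (is_deriveM (dg j) (dg j)).
rewrite (_ : (fun t => _) = \sum_(j < n) (g j * g j)); last first.
  apply/funext => t; rewrite fct_sumE; apply: eq_bigr => j _.
  by rewrite !mxE.
apply: is_derive_eq D _; rewrite /dot mulr_sumr; apply: eq_bigr => j _.
rewrite /g scale0r addr0 ext_val // !xpartE [(row _ _) _ _]mxE.
rewrite [(xpart _ - v) _ _]mxE [(- v) _ _]mxE xpartE /GRing.scale /=; ring.
Qed.

Lemma ext_tangent_cont q : O q -> mx_cont_at q ext_tangent.
Proof.
move=> Oq i e; rewrite (_ : (fun x => _) =
  (fun x => ('D_(delta_mx 0 i) G x) 0 e)); last first.
  by apply/funext => x; rewrite mxE.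
exact: (differentiable_cont_entry (smooth_diff1 sG i Oq)).
Qed.

Lemma ext_second_cont q i j : O q -> mx_cont_at q (fun x => ext_second x i j).
Proof.
by move=> Oq; exact: (differentiable_cont_entry (smooth_diff2 sG i j Oq)).
Qed.

(** The coordinates of a minimal immersion solve an elliptic equation. *)
Lemma minimal_elliptic (a : R) e q : O q -> H q ->
  row_free (tangent_mx X q) ->
  (forall nu, unit_normal X q nu -> mean_curvature X q nu = 0) ->
  let u := a *: (fun x => G x 0 e) in
  let B := elliptic_root (ext_tangent q) in
  \sum_b \sum_i \sum_j B i b * B j b * pd i (pd j u) q =
  \sum_i drift (ext_tangent q) (ext_second q) 0 i * pd i u q.
Proof.
move=> Oq Hq; rewrite tangent_mx_ext // => fT mH u B.
have key nu : (forall i, dot (row i (ext_tangent q)) nu = 0) ->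
    dot nu nu = 1 -> \tr (invmx (ext_tangent q *m (ext_tangent q)^T) *m
      \matrix_(i, j) dot (ext_second q i j) nu) = 0.
  move=> nT nu1.
  have <- : second_form X q nu = \matrix_(i, j) dot (ext_second q i j) nu.
    by apply/matrixP => i j; rewrite [LHS]mxE [RHS]mxE hpartial2_ext.
  rewrite -tangent_mx_ext //; apply: mH; split=> // i.
  by rewrite hpartial_ext // -(nT i) rowK.
have := congr1 ( *%R a) (elliptic_identity fT key e); rewrite !mulr_sumr.
congr (_ = _); last first.
  apply: eq_bigr => i _.
  by rewrite (pd_coord1 oO sG) // mulrCA [ext_tangent q i e]mxE.
apply: eq_bigr => b _; rewrite mulr_sumr; apply: eq_bigr => i _.
rewrite mulr_sumr; apply: eq_bigr => j _.
by rewrite (pd_coord2 oO sG) // mulrCA.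
Qed.

(** Strong maximum principle in a chart, for a multiple of a coordinate whose
    gradient vanishes wherever the maximum is attained. *)
Lemma chart_strong_max (i0 : 'I_n) (a m : R) e q0 : i0 = 0%N :> nat ->
  O q0 -> H q0 ->
  (forall q, chart_cod c q -> row_free (tangent_mx X q)) ->
  (forall q, chart_cod c q -> forall nu, unit_normal X q nu ->
    mean_curvature X q nu = 0) ->
  (forall q, chart_cod c q -> a * X q 0 e <= m) -> a * X q0 0 e = m ->
  (forall q, chart_cod c q -> a * X q 0 e = m ->
    forall i, hpartial i X q 0 e = 0) ->
  \forall q \near q0, H q -> a * X q 0 e = m.
Proof.
move=> i0E Oq0 Hq0 fT mH le_m eq_m crit.
pose u := a *: (fun x => G x 0 e).
have uE q : O q -> H q -> u q = a * X q 0 e.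
  by move=> Oq Hq; rewrite (ext_eq ext).
have near_u : \forall q \near q0, H q -> u q = m.
  apply: (@strong_max R n (n + 1) i0 i0E u O
    (fun q => elliptic_root (ext_tangent q))
    (fun q => drift (ext_tangent q) (ext_second q)) m) => //.
  - exact: twice_diff_coord.
  - by move=> q Oq; apply: mx_cont_at_elliptic_root; exact: ext_tangent_cont.
  - move=> q Oq; apply: mx_cont_at_drift; first exact: ext_tangent_cont.
    by move=> i j; exact: ext_second_cont.
  - move=> q Oq Hq; apply: elliptic_root_free.
    by rewrite -tangent_mx_ext //; exact/fT/(ext_cod ext).
  - move=> q Oq Hq; have cq := ext_cod ext Oq Hq.
    by apply: minimal_elliptic => //; [exact: fT | exact: mH].
  - by move=> q Oq Hq; rewrite uE //; exact/le_m/(ext_cod ext).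
  - move=> q Oq Hq; rewrite uE // => /(crit _ (ext_cod ext Oq Hq)) h i.
    by rewrite (pd_coord1 oO sG) // -hpartial_ext // h mulr0.
  - by rewrite uE.
have nO : \forall q \near q0, O q by exact: open_nbhs_nbhs.
by apply: filterS2 nO near_u => q Oq h Hq; rewrite -uE // h.
Qed.

End ChartLocal.

(** * The free boundary condition *)

Section CylinderNormal.
Variables (R : realType) (n : nat) (w : R -> R).
Implicit Types (p : 'rV[R]_(n + 1)).

(** The normalization factor of [cylinder_normal]. *)
Definition normal_factor p : R := (Num.sqrt (1 + derive1 w (zpart p) ^+ 2))^-1.

Lemma normal_factor_gt0 p : 0 < normal_factor p.
Proof. by rewrite invr_gt0 sqrtr_gt0 ltr_pwDl // sqr_ge0. Qed.

Lemma dot_cylinder_normal v p : dot v (cylinder_normal w p) =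
  normal_factor p * ((enorm (xpart p))^-1 * dot (xpart v) (xpart p)
    - derive1 w (zpart p) * zpart v).
Proof.
rewrite dotZr; congr (_ * _).
rewrite dot_split xpart_row_mx zpart_row_mx dotZr mxE eqxx mulr1n.
by rewrite mulrN (mulrC (zpart v)).
Qed.

Lemma zpart_cylinder_normal p :
  zpart (cylinder_normal w p) = - (normal_factor p * derive1 w (zpart p)).
Proof. by rewrite zpartZ zpart_row_mx mxE eqxx mulr1n mulrN. Qed.

Lemma cylinder_normal_gt0 p : 0 < enorm (xpart p) ->
  0 < dot (cylinder_normal w p) (cylinder_normal w p).
Proof.
move=> x0; rewrite dot_gt0; apply/eqP => N0.
have := dot_cylinder_normal (row_mx (xpart p) 0) p.
rewrite N0 dot0r xpart_row_mx zpart_row_mx mxE mulr0 subr0 -sqr_enorm expr2.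
rewrite mulKf ?gt_eqF //.
by move/esym/eqP; rewrite gt_eqF // mulr_gt0 // normal_factor_gt0.
Qed.

End CylinderNormal.

Section FreeBoundary.
Variables (R : realType) (n : nat) (i0 : 'I_n) (i0E : i0 = 0%N :> nat).
Variables (w : R -> R) (P : set R) (hw : pinching_profile w P).
Variables (M : topologicalType) (A : set (chart R M n)) (F : M -> 'rV[R]_(n + 1)).
Hypothesis hF : minimal_free_boundary A F w P.
Hypothesis hin : forall p, enorm (xpart (F p)) <= w (zpart (F p)).
Notation H := (@halfspace R n).
Notation zi := (rshift n (ord0 : 'I_1)).

Lemma chart_codP c q : A c -> chart_cod c q ->
  chart_dom c (chart_inv c q) /\ chart_map c (chart_inv c q) = q.
Proof.
move=> Ac [p dp <-].
by rewrite (chart_mapK (mfd_chart (mfb_manifold hF) Ac) dp).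
Qed.

Lemma chart_bd c q : A c -> chart_cod c q -> q 0 i0 = 0 ->
  mfd_boundary A (chart_inv c q).
Proof.
move=> Ac cq q0; have [dq mq] := chart_codP Ac cq.
by exists c; split=> //; rewrite mq; exists i0.
Qed.

Lemma boundary_cylinder p : mfd_boundary A p ->
  enorm (xpart (F p)) = w (zpart (F p)) /\ ~ P (zpart (F p)).
Proof. by move=> bp; apply: (fb_incl (mfb_free hF)); exists p. Qed.

Lemma profile_derivable z : ~ P z -> derivable w z 1.
Proof. move=> nP; exact: (@profile_smooth _ _ _ hw 0%N z nP). Qed.

(** The image [q] under a chart of a boundary point of the manifold: it lies on
    the boundary hyperplane, and coordinate [i0] is the inner direction. *)
Section AtBoundaryPoint.
Variables (c : chart R M n) (Ac : A c) (q : 'rV[R]_n).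
Hypothesis cq : chart_cod c q.
Hypothesis q0 : q 0 i0 = 0.
Let X := F \o chart_inv c.
Let N := cylinder_normal w (X q).
Variables (O : set 'rV[R]_n) (G : 'rV[R]_n -> 'rV[R]_(n + 1)).
Hypothesis ext : local_ext c X O G.
Hypothesis Oq : O q.
Hypothesis Hq : H q.
Let T := ext_tangent G q.

Let oO := ext_open ext.
Let sG := ext_smooth ext.

(** The derivative along the coordinate curves of [|x|^2 - w(z)^2], which
    vanishes on the cylinder and is nonpositive on the region it bounds. *)
Lemma is_derive_defect i :
  is_derive (0 : R) (1 : R)
    (fun t => dot (xpart (G (q + t *: delta_mx 0 i)))
        (xpart (G (q + t *: delta_mx 0 i)))
      - w (zpart (G (q + t *: delta_mx 0 i))) ^+ 2)
    (2 * (dot (xpart (row i T)) (xpart (X q))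
      - w (zpart (X q)) * derive1 w (zpart (X q)) * T i zi)).
Proof.
have [_ nP] := boundary_cylinder (chart_bd Ac cq q0).
have dw : is_derive (G (q + 0 *: delta_mx 0 i) 0 zi) (1 : R) w
    (derive1 w (zpart (X q))).
  rewrite scale0r addr0 (ext_val ext Oq Hq) derive1E; apply: derivableP.
  exact: profile_derivable nP.
have dwz := is_derive1_comp dw (is_derive_ext_entry ext Oq i zi).
have D := is_deriveB (is_derive_ext_dist ext Oq Hq 0 i) (is_deriveM dwz dwz).
rewrite (_ : (fun t => _) = (fun t : R =>
    dot (xpart (G (q + t *: delta_mx 0 i)) - 0)
        (xpart (G (q + t *: delta_mx 0 i)) - 0)) -
    ((w \o (fun t : R => G (q + t *: delta_mx 0 i) 0 zi)) *
    (w \o (fun t : R => G (q + t *: delta_mx 0 i) 0 zi)))); last first.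
  by apply/funext => t; rewrite !fctE subr0 expr2.
apply: is_derive_eq D _.
rewrite /= scale0r addr0 (ext_val ext) // subr0 mulrBr; congr (_ - _).
by rewrite /GRing.scale /= /T; ring.
Qed.

(** That derivative is a positive multiple of the component of the tangent
    vector along the cylinder normal. *)
Lemma defect_normal i : dot (xpart (row i T)) (xpart (X q))
      - w (zpart (X q)) * derive1 w (zpart (X q)) * T i zi =
  w (zpart (X q)) / normal_factor w (X q) * dot (row i T) N.
Proof.
have [ew nP] := boundary_cylinder (chart_bd Ac cq q0).
have w0 := profile_gt0 hw nP; have k0 := normal_factor_gt0 w (X q).
rewrite /N dot_cylinder_normal ew.
have -> : zpart (row i T) = T i zi by rewrite /zpart mxE.
field.
by rewrite !gt_eqF.
Qed.

Lemma tangential_line i t : i != i0 -> (q + t *: delta_mx 0 i) 0 i0 = 0.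
Proof. by move=> ii0; rewrite !mxE q0 eq_sym (negPf ii0) andbF mulr0 addr0. Qed.

Lemma tangential_halfspace i t : i != i0 -> H (q + t *: delta_mx 0 i).
Proof. by move=> ii0; apply/(halfspaceE i0E); rewrite tangential_line. Qed.

Lemma dot_normal_factor_gt0 : 0 < w (zpart (X q)) / normal_factor w (X q).
Proof.
have [_ nP] := boundary_cylinder (chart_bd Ac cq q0).
by rewrite divr_gt0 ?normal_factor_gt0 // (profile_gt0 hw nP).
Qed.

(** Boundary curves stay on the cylinder. *)
Lemma tangent_dot_normal_eq0 i : i != i0 -> dot (row i T) N = 0.
Proof.
move=> ii0; have D := is_derive_defect i.
have : 2 * (w (zpart (X q)) / normal_factor w (X q) * dot (row i T) N) = 0.
  rewrite -defect_normal; apply: is_derive_max D _.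
  apply: filterS (near_ext_line ext i Oq) => t Ot.
  rewrite scale0r addr0 (ext_val ext Oq Hq) 
    -(ext_eq ext Ot (tangential_halfspace t ii0)).
  have E y : chart_cod c y -> y 0 i0 = 0 ->
      dot (xpart (X y)) (xpart (X y)) - w (zpart (X y)) ^+ 2 = 0.
    move=> cy y0; have [<- _] := boundary_cylinder (chart_bd Ac cy y0).
    by rewrite sqr_enorm subrr.
  rewrite !E //; last exact: tangential_line.
  exact: (ext_cod ext Ot (tangential_halfspace t ii0)).
move/eqP; rewrite !mulf_eq0 pnatr_eq0 /= -mulf_eq0 gt_eqF ?dot_normal_factor_gt0 //=.
by move/eqP.
Qed.

(** The inner coordinate curve stays in the region bounded by the cylinder. *)
Lemma tangent_dot_normal_le0 : dot (row i0 T) N <= 0.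
Proof.
have D := is_derive_defect i0.
have : 2 * (w (zpart (X q)) / normal_factor w (X q) * dot (row i0 T) N) <= 0.
  rewrite -defect_normal; apply: is_derive_right_le D _.
  apply: filterS (near_ext_line ext i0 Oq) => t Ot t0.
  rewrite scale0r addr0 (ext_val ext Oq Hq) 
    -(ext_eq ext Ot (halfspace_shift i0 Hq (ltW t0))).
  have [E _] := boundary_cylinder (chart_bd Ac cq q0).
  rewrite -[w (zpart (X q))]E sqr_enorm subrr subr_le0.
  rewrite -enorm_le; last exact: (profile_ge0 hw).
  exact: hin.
by rewrite pmulr_rle0 // pmulr_rle0 // dot_normal_factor_gt0.
Qed.

(** The cylinder normal is tangent to the hypersurface; its coefficient along
    the inner coordinate direction is negative. *)
Lemma normal_in_tangent : exists2 al : 'rV[R]_n,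
  N = al *m T & al 0 i0 < 0.
Proof.
have cqT := tangent_mx_ext ext Oq Hq.
have fT : row_free T.
  by rewrite /T -cqT; apply: (mfb_immersion hF Ac).2.
have [dq mq] := chart_codP Ac cq.
have NT : N = (N *m T^T *m invmx (T *m T^T)) *m T.
  apply: row_space_of_normals => // nu nT nu1; rewrite dotC.
  apply: (fb_orth (mfb_free hF) Ac dq (chart_bd Ac cq q0)).
  rewrite mq; split=> // i; rewrite (hpartial_ext ext) // -(nT i).
  by rewrite /T rowK.
exists (N *m T^T *m invmx (T *m T^T)) => //.
set al := _ *m invmx _ in NT *.
have NN : dot N N = al 0 i0 * dot (row i0 T) N.
  rewrite {1}NT mulmx_sum_row dot_suml (bigD1 i0) //= big1 ?addr0 ?dotZl //.
  by move=> i ii0; rewrite dotZl tangent_dot_normal_eq0 // mulr0.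
have [E nP] := boundary_cylinder (chart_bd Ac cq q0).
have : 0 < dot N N.
  by apply: cylinder_normal_gt0; rewrite E; exact: (profile_gt0 hw nP).
rewrite NN => h; rewrite ltNge; apply/negP => al0.
by move: h; rewrite ltNge mulr_ge0_le0 // tangent_dot_normal_le0.
Qed.

(** At a boundary maximum of [a * z], the height does not vary along the boundary
    and [a * z] does not increase inwards. Comparing the heights in
    [normal_in_tangent] then shows that the inner derivative of [z] is a
    positive multiple of [w']. *)
Lemma boundary_max (a m : R) : a != 0 ->
  (forall p, a * zpart (F p) <= m) -> a * zpart (X q) = m ->
  a * derive1 w (zpart (X q)) <= 0 /\
  (derive1 w (zpart (X q)) = 0 -> forall i, hpartial i X q 0 zi = 0).
Proof.
move=> a0 le_m eq_m.
have D i : is_derive (0 : R) (1 : R)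
    (fun t => a * G (q + t *: delta_mx 0 i) 0 zi) (a * T i zi).
  exact: is_deriveZ (is_derive_ext_entry ext Oq i zi).
have Ti i : i != i0 -> T i zi = 0.
  move=> ii0; have : a * T i zi = 0.
    apply: is_derive_max (D i) _; apply: filterS (near_ext_line ext i Oq) => t Ot.
    rewrite scale0r addr0 (ext_val ext Oq Hq) 
    -(ext_eq ext Ot (tangential_halfspace t ii0)).
    by move: eq_m; rewrite /zpart => ->; exact: le_m.
  by move/eqP; rewrite mulf_eq0 (negPf a0) => /eqP.
have T0 : a * T i0 zi <= 0.
  apply: is_derive_right_le (D i0) _.
  apply: filterS (near_ext_line ext i0 Oq) => t Ot t0.
  rewrite scale0r addr0 (ext_val ext Oq Hq) 
    -(ext_eq ext Ot (halfspace_shift i0 Hq (ltW t0))).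
  by move: eq_m; rewrite /zpart => ->; exact: le_m.
have [al NT al0] := normal_in_tangent.
have zN : normal_factor w (X q) * derive1 w (zpart (X q)) = - (al 0 i0 * T i0 zi).
  apply: oppr_inj; rewrite opprK -zpart_cylinder_normal -/N NT /zpart mxE.
  by rewrite (bigD1 i0) //= big1 ?addr0 // => i ii0; rewrite Ti // mulr0.
have k0 := normal_factor_gt0 w (X q); split.
  rewrite -(pmulr_rle0 _ k0) mulrCA zN mulrN mulrCA oppr_le0.
  by rewrite nmulr_rge0.
move=> w0 i; have -> : hpartial i X q 0 zi = T i zi.
  by rewrite (hpartial_ext ext) // mxE.
have [->|/Ti //] := eqVneq i i0.
move/eqP: zN; rewrite w0 mulr0 eq_sym oppr_eq0 mulf_eq0 lt_eqF //=.
by move/eqP.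
Qed.

End AtBoundaryPoint.
End FreeBoundary.

(** * Extremal heights *)

Section Height.
Variables (R : realType) (n : nat) (i0 : 'I_n) (i0E : i0 = 0%N :> nat).
Variables (w : R -> R) (P : set R) (hw : pinching_profile w P).
Variables (M : topologicalType) (A : set (chart R M n)) (F : M -> 'rV[R]_(n + 1)).
Hypothesis hF : minimal_free_boundary A F w P.
Hypothesis hin : forall p, enorm (xpart (F p)) <= w (zpart (F p)).
Notation H := (@halfspace R n).
Notation zi := (rshift n (ord0 : 'I_1)).

(** Every point lies in a chart, near the image of which the parametrization
    has a smooth extension. *)
Lemma chart_at (p : M) : exists c, [/\ A c, chart_dom c p,
  chart_cod c (chart_map c p),
  H (chart_map c p) & exists O G,
  local_ext c (F \o chart_inv c) O G /\ O (chart_map c p)].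
Proof.
have [c Ac dp] := mfd_cover (mfb_manifold hF) p.
have ic := mfd_chart (mfb_manifold hF) Ac.
have cq : chart_cod c (chart_map c p) by exists p.
have [Hq [U [G [ext Oq]]]] := local_extP ic (mfb_immersion hF Ac).1 cq.
by exists c; split=> //; exists U, G.
Qed.

Lemma near_chart c p (Q : 'rV[R]_n -> Prop) : A c -> chart_dom c p ->
  (\forall q \near chart_map c p, H q -> Q q) ->
  \forall p' \near p, chart_dom c p' /\ Q (chart_map c p').
Proof.
move=> Ac dp nQ; have ic := mfd_chart (mfb_manifold hF) Ac.
have dO := chart_dom_open ic.
have nd : \forall p' \near p, chart_dom c p' by exact: open_nbhs_nbhs.
have cm : {for p, continuous (chart_map c)}.
  have := chart_map_cont ic; rewrite continuous_open_subspace //.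
  by apply; rewrite inE.
have nq : \forall p' \near p, H (chart_map c p') -> Q (chart_map c p').
  exact: (cm _ nQ).
apply: filterS2 nd nq => p' dp' h; split=> //; apply: h.
have [U _ E] := chart_cod_open ic.
by have [] : (U `&` H) (chart_map c p') by rewrite -E; exists p'.
Qed.

Lemma immersion_cont e p : {for p, continuous (fun p' => F p' 0 e)}.
Proof.
have [c [Ac dp cq Hq [U [G [ext Oq]]]]] := chart_at p.
have pK := chart_mapK (mfd_chart (mfb_manifold hF) Ac) dp.
have cG : {for chart_map c p, continuous (fun q => G q 0 e)}.
  exact: (differentiable_cont_entry (smooth_diff (ext_smooth ext) Oq)).
have Gp : G (chart_map c p) = F p by rewrite (ext_val ext) //= pK.
move=> B; rewrite -Gp => /cG nB.
have nO : \forall q \near chart_map c p, U q.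
  by apply: open_nbhs_nbhs; split=> //; exact: (ext_open ext).
have : \forall q \near chart_map c p, H q -> B (F (chart_inv c q) 0 e).
  apply: filterS2 nO nB => q Oq' /= h Hq'.
  by have := ext_val ext Oq' Hq'; rewrite /= => <-.
move/(near_chart Ac dp); apply: filterS => p' [dp'].
by rewrite (chart_mapK (mfd_chart (mfb_manifold hF) Ac) dp').
Qed.

Lemma interior_shift (q : 'rV[R]_n) i : 0 < q 0 i0 ->
  \forall t \near (0 : R), H (q + t *: delta_mx 0 i).
Proof.
move=> q0; have := near_line (delta_mx 0 i) (near_pos q0).
by apply: filterS => t h; apply/(halfspaceE i0E)/ltW.
Qed.

(** If the maximum of a multiple [a] of the height is not attained at a boundary
    point with [a * w' < 0], then the gradient of the height vanishes wherever
    the maximum is attained, and the height is constant. *)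
Lemma height_dichotomy (a m : R) : a != 0 ->
  (forall p, a * zpart (F p) <= m) -> (exists p, a * zpart (F p) = m) ->
  (exists p, [/\ mfd_boundary A p, a * zpart (F p) = m &
     a * derive1 w (zpart (F p)) < 0]) \/
  (forall p, a * zpart (F p) = m).
Proof.
move=> a0 le_m [p0 eq_m].
have [ex|nex] := pselect (exists p, [/\ mfd_boundary A p, a * zpart (F p) = m &
     a * derive1 w (zpart (F p)) < 0]); [by left | right].
have crit c q : A c -> chart_cod c q ->
    a * (F \o chart_inv c) q 0 zi = m ->
    forall i, hpartial i (F \o chart_inv c) q 0 zi = 0.
  move=> Ac cq eq i; have ic := mfd_chart (mfb_manifold hF) Ac.
  have [Hq [U [G [ext Oq]]]] := local_extP ic (mfb_immersion hF Ac).1 cq.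
  have [q0|q0] := eqVneq (q 0 i0) 0.
    have [dle dz] := boundary_max i0E hw hF hin Ac cq q0 ext Oq Hq a0 le_m eq.
    apply: dz; apply/eqP; rewrite -[_ == 0](mulrI_eq0 _ (mulfI a0)).
    rewrite eq_le dle leNgt; apply/negP => dlt; apply: nex.
    by exists (chart_inv c q); split=> //; exact: (chart_bd i0E hF).
  have qpos : 0 < q 0 i0 by rewrite lt_def q0 (halfspaceE i0E q).1.
  rewrite (hpartial_ext ext) //.
  have D := is_deriveZ a (is_derive_ext_entry ext Oq i zi).
  have /eqP : a * ext_tangent G q i zi = 0.
    apply: is_derive_max D _.
    apply: filterS2 (near_ext_line ext i Oq) (interior_shift i qpos) => t Ot Ht.
    rewrite /= scale0r addr0 (ext_val ext Ot Ht) (ext_val ext Oq Hq).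
    by rewrite [leRHS]eq; exact: le_m.
  by rewrite mulf_eq0 (negPf a0) /= mxE => /eqP.
move=> p; apply: (@connected_level R M setT (fun p => a * zpart (F p)) m
  (mfb_connected hF) closedT _ _ p0 p) => //.
  move=> t _; apply: cont_at_mul; first exact: cvg_cst.
  exact: immersion_cont.
move=> t _ eq_t; have [c [Ac dt cq Hq [U [G [ext Oq]]]]] := chart_at t.
have tK := chart_mapK (mfd_chart (mfb_manifold hF) Ac) dt.
have [imm rf] := mfb_immersion hF Ac.
have := @chart_strong_max R n M c (F \o chart_inv c) U G ext i0 a m zi
  (chart_map c t) i0E Oq Hq rf (mfb_minimal hF Ac) _ _ (crit c ^~ Ac).
rewrite /= tK => /(_ (fun q _ => le_m _) eq_t) /(near_chart Ac dt).
apply: filterS => p' [dp'].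
by rewrite (chart_mapK (mfd_chart (mfb_manifold hF) Ac) dp').
Qed.

Lemma height_max (a : R) : exists p0, forall p, a * zpart (F p) <= a * zpart (F p0).
Proof.
have [p1 _] := mfb_boundary hF.
have [p0 _ h] : exists2 p0, p0 \in [set: M] &
    forall p, p \in [set: M] -> a * zpart (F p) <= a * zpart (F p0).
  apply: compact_EVT_max; [by exists p1 | exact: (mfb_compact hF) |].
  apply: continuous_in_subspaceT => p _.
  exact: (cont_at_mul (cvg_cst a) (@immersion_cont zi p)).
by exists p0 => p; apply: h; rewrite inE.
Qed.

End Height.

(** * Profiles of shrinking neck regions *)

Section Profile.
Variables (R : realType) (w : R -> R) (P : set R).
Hypothesis hw : pinching_profile w P.

Lemma is_derive_translate z : ~ P z ->
  is_derive (0 : R) (1 : R) (fun h => w (z + h)) (derive1 w z).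
Proof.
move=> nP; have dw : is_derive (z + 0) (1 : R) w (derive1 w z).
  by rewrite addr0 derive1E; apply: derivableP; exact: (profile_derivable hw nP).
have dz : is_derive (0 : R) (1 : R) (fun h : R => z + h) (0 + 1).
  exact: (is_deriveD (is_derive_cst _ _ _) (is_derive_id _ _)).
by apply: is_derive_eq (is_derive1_comp dw dz) _; rewrite add0r mulr1.
Qed.

(** The leftmost maximum point of [w] between [a] and [b] would be a critical
    point that is not a weak local minimum. *)
Lemma no_interior_hump z1 z2 (a b : R) : shrinking_neck w z1 z2 ->
  a < b -> (z1 < a%:E)%E -> (b%:E < z2)%E -> ~ P a -> ~ P b ->
  0 < derive1 w a -> derive1 w b < 0 -> False.
Proof.
move=> hneck ab z1a bz2 nPa nPb wa wb.
have abc t : `[a, b]%classic t = (a <= t <= b) by rewrite /= in_itv.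
have ab0 : `[a, b]%classic !=set0 by exists a; rewrite abc lexx ltW.
have wc t : {for t, continuous w} by exact: (profile_cont hw).
have [c /set_mem cab cmax] : exists2 c, c \in `[a, b]%classic &
    forall t, t \in `[a, b]%classic -> w t <= w c.
  apply: compact_EVT_max => //; first exact: segment_compact.
  by apply: continuous_in_subspaceT => t _; exact: wc.
pose E := `[a, b]%classic `&` [set t | w t = w c].
have cE : compact E.
  apply: (subclosed_compact _ (@segment_compact R a b)); last by move=> t [].
  by apply: closed_level => [|t _]; [exact: interval_closed | exact: wc].
have [t0 /set_mem [t0ab wt0] t0min] : exists2 t0, t0 \in E &
    forall t, t \in E -> t0 <= t.
  apply: (@compact_EVT_min R R id) => //; first by exists c.
  by apply: continuous_in_subspaceT => t _; exact: cvg_id.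
have le_t0 t : a <= t <= b -> w t <= w t0.
  by move=> tab; rewrite [leRHS]wt0; apply: cmax; rewrite inE abc.
have ba : 0 < b - a by rewrite subr_gt0.
have t0a : t0 != a.
  apply: contraTneq wa => t0E; rewrite -leNgt.
  apply: is_derive_right_le (is_derive_translate nPa) _.
  have : \forall h \near (0 : R), h < b - a.
    exact: (@cvgr_lt R _ (nbhs (0 : R)) _ id 0 cvg_id (b - a) ba).
  apply: filterS => h hb h0; rewrite addr0 -t0E; apply: le_t0.
  by rewrite t0E; apply/andP; split; lra.
have t0b : t0 != b.
  apply: contraTneq wb => t0E; rewrite -leNgt -oppr_le0.
  apply: is_derive_right_le (is_derive_flip (is_derive_translate nPb)) _.
  have : \forall h \near (0 : R), h < b - a.
    exact: (@cvgr_lt R _ (nbhs (0 : R)) _ id 0 cvg_id (b - a) ba).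
  apply: filterS => h hb h0; rewrite oppr0 addr0 -t0E; apply: le_t0.
  by rewrite t0E; apply/andP; split; lra.
move: (t0ab); rewrite abc => /andP[at0 tb0].
have {}at0 : a < t0 by rewrite lt_def t0a.
have {}tb0 : t0 < b by rewrite lt_def eq_sym t0b.
(* at a pinching point [w] vanishes, below its positive value at [a] *)
have nP0 : ~ P t0.
  move=> /(profile_pinch hw) w0; have := le_t0 a; rewrite lexx ltW //= w0.
  by rewrite leNgt (profile_gt0 hw nPa) => /(_ isT).
have near_in : \forall h \near (0 : R), a <= t0 + h <= b.
  have e0 : 0 < Num.min (t0 - a) (b - t0) by rewrite lt_min !subr_gt0 at0.
  apply/nbhs_ballP; exists (Num.min (t0 - a) (b - t0)) => //= h.
  rewrite -ball_normE /= sub0r normrN lt_min !ltr_norml.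
  move=> /andP[/andP[h1 h2] /andP[h3 h4]].
  by apply/andP; split; lra.
have D0 : is_derive t0 (1 : R) w 0.
  have <- : derive1 w t0 = 0.
    apply: is_derive_max (is_derive_translate nP0) _.
    by apply: filterS near_in => h; rewrite addr0; exact: le_t0.
  by rewrite derive1E; apply: derivableP; exact: (profile_derivable hw nP0).
have z12 : (z1 < t0%:E < z2)%E.
  by rewrite (lt_trans z1a) ?lte_fin //= (lt_trans _ bz2) ?lte_fin.
have := hneck t0 z12 D0; case/nbhs_ballP => e /= e0 He.
have [r r0 Hr] := nbhs0_itv near_in.
pose h := Num.min e r / 2.
have m0 : 0 < Num.min e r by rewrite lt_min e0 r0.
have h0 : 0 < h by rewrite divr_gt0.
have : h < Num.min e r by rewrite /h; lra.
rewrite lt_min => /andP[he hr].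
have hab : a <= t0 - h <= b by apply: Hr; rewrite normrN gtr0_norm.
have whe : w t0 <= w (t0 - h).
  by apply: He; rewrite -ball_normE /= opprB addrC subrK gtr0_norm.
have /t0min : t0 - h \in E.
  apply: mem_set; split; first by rewrite abc.
  by rewrite /= -wt0; apply/eqP; rewrite eq_le whe le_t0.
by rewrite leNgt ltrBlDr ltrDl h0.
Qed.

End Profile.

(** * Flat hypersurfaces fill the disk *)

Lemma eq_split (R : realType) (n : nat) (p p' : 'rV[R]_(n + 1)) :
  xpart p = xpart p' -> zpart p = zpart p' -> p = p'.
Proof.
move=> ex ez; rewrite -(hsubmxK p) -(hsubmxK p'); congr (row_mx _ _) => //.
by apply/rowP => j; rewrite (ord1 j) !mxE; exact: ez.
Qed.

Section Flat.
Variables (R : realType) (n : nat) (i0 : 'I_n) (i0E : i0 = 0%N :> nat).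
Variables (w : R -> R) (P : set R) (hw : pinching_profile w P).
Variables (M : topologicalType) (A : set (chart R M n)) (F : M -> 'rV[R]_(n + 1)).
Hypothesis hF : minimal_free_boundary A F w P.
Hypothesis hin : forall p, enorm (xpart (F p)) <= w (zpart (F p)).
Variable zs : R.
Hypothesis hz : forall p, zpart (F p) = zs.
Notation H := (@halfspace R n).
Notation zi := (rshift n (ord0 : 'I_1)).

Lemma radius_gt0 : 0 < w zs.
Proof.
have [p bp] := mfb_boundary hF; have [_] := boundary_cylinder hF bp.
by rewrite hz => /(profile_gt0 hw).
Qed.

Lemma sqr_radius_le p : dot (xpart (F p)) (xpart (F p)) <= w zs ^+ 2.
Proof. by rewrite -enorm_le ?(ltW radius_gt0) // -(hz p); exact: hin. Qed.

(** At an interior point of a flat hypersurface the projection to the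
    hyperplane is a local diffeomorphism, so a quadratic function of the
    projection with a maximum there has vanishing gradient. *)
Lemma interior_critical c q (y : 'rV[R]_n) (a b : R) : A c -> chart_cod c q ->
  0 < q 0 i0 ->
  let Q x := a * dot x x + b * dot (x - y) (x - y) in
  let x0 := xpart (F (chart_inv c q)) in
  (forall p, Q (xpart (F p)) <= Q x0) -> a *: x0 + b *: (x0 - y) = 0.
Proof.
move=> Ac cq qpos Q x0 Qmax; have ic := mfd_chart (mfb_manifold hF) Ac.
have [imm rf] := mfb_immersion hF Ac.
have [Hq [U [G [ext Uq]]]] := local_extP ic imm cq.
set V := _ + _; pose T := ext_tangent G q.
have fT : row_free T by rewrite /T -(tangent_mx_ext ext Uq Hq); exact: rf.
have near_H i : \forall t \near (0 : R), U (q + t *: delta_mx 0 i) /\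
    H (q + t *: delta_mx 0 i).
  exact: filterI (near_ext_line ext i Uq) (interior_shift i0E i qpos).
have zT i : T i zi = 0.
  apply: is_derive_max (is_derive_ext_entry ext Uq i zi) _.
  apply: filterS (near_H i) => t [Ut Ht].
  rewrite scale0r addr0 (ext_val ext Ut Ht) (ext_val ext Uq Hq) /=.
  by have := hz (chart_inv c q); have := hz (chart_inv c (q + t *: delta_mx 0 i));
    rewrite /zpart => -> ->.
have perp i : dot (xpart (row i T)) V = 0.
  have D := is_deriveD
    (is_deriveZ a (is_derive_ext_dist ext Uq Hq 0 i))
    (is_deriveZ b (is_derive_ext_dist ext Uq Hq y i)).
  have E : a *: (2 * dot (xpart (row i T)) (x0 - 0)) +
      b *: (2 * dot (xpart (row i T)) (x0 - y)) = 0.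
    apply: is_derive_max D _; apply: filterS (near_H i) => t [Ut Ht].
    have := Qmax (chart_inv c (q + t *: delta_mx 0 i)).
    rewrite /Q /x0 !fctE /= scale0r addr0 (ext_val ext Ut Ht) (ext_val ext Uq Hq) /=.
    by rewrite !subr0.
  have : 2 * dot (xpart (row i T)) V = 0.
    rewrite /V [X in 2 * X = _]dotDr [X in 2 * (X + _)]dotZr.
    rewrite [X in 2 * (_ + X)]dotZr; apply: etrans E.
    by rewrite subr0 /GRing.scale /=; ring.
  by move/eqP; rewrite mulf_eq0 pnatr_eq0 => /eqP.
have fL : row_free (lsubmx T).
  apply/inj_row_free => v vT; apply: (row_free_inj fT); rewrite mul0mx.
  apply: eq_split.
    apply/rowP => j; move/rowP/(_ j): vT; rewrite !mxE => E; rewrite -[RHS]E.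
    by apply: eq_bigr => k _; rewrite !mxE.
  by rewrite /zpart !mxE big1 // => k _; rewrite zT mulr0.
have uL : (lsubmx T)^T \in unitmx by rewrite unitmx_tr -row_free_unit.
have : V *m (lsubmx T)^T = 0.
  apply/rowP => i; rewrite !mxE -[RHS](perp i); apply: eq_bigr => j _.
  by rewrite xpartE !mxE mulrC.
by move=> /(congr1 (mulmx^~ (invmx (lsubmx T)^T))); rewrite /= mulmxK // mul0mx.
Qed.

(** Boundary points are mapped to the boundary sphere of the disk. *)
Lemma interior_of_small c p : A c -> chart_dom c p ->
  dot (xpart (F p)) (xpart (F p)) < w zs ^+ 2 -> 0 < chart_map c p 0 i0.
Proof.
move=> Ac dp small; have ic := mfd_chart (mfb_manifold hF) Ac.
have cq : chart_cod c (chart_map c p) by exists p.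
have [Hq _] := local_extP ic (mfb_immersion hF Ac).1 cq.
rewrite lt_def (halfspaceE i0E _).1 // andbT; apply: contraTneq small => q0.
have [] := boundary_cylinder hF (chart_bd i0E hF Ac cq q0).
by rewrite (chart_mapK ic dp) hz -sqr_enorm => -> _; rewrite ltxx.
Qed.

(** An interior point cannot be mapped to the boundary sphere, where [|x|] is
    maximal. *)
Lemma exists_small : exists p, dot (xpart (F p)) (xpart (F p)) < w zs ^+ 2.
Proof.
have [p bp] := mfb_boundary hF.
have [c [Ac dp cq Hq [U [G [ext Uq]]]]] := chart_at hF p.
have [e e0 He] := nbhs0_itv (near_ext_line ext i0 Uq).
set q := chart_map c p in cq Hq Uq He.
have e2 : 0 < e / 2 by rewrite divr_gt0.
pose q' := q + (e / 2) *: delta_mx 0 i0.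
have Uq' : U q' by apply: He; rewrite gtr0_norm //; lra.
have Hq' : H q' by apply: halfspace_shift => //; exact: ltW.
have cq' := ext_cod ext Uq' Hq'.
have q'0 : 0 < q' 0 i0.
  rewrite !mxE !eqxx mulr1 ltr_wpDl //; exact: (halfspaceE i0E q).1.
exists (chart_inv c q'); rewrite lt_neqAle sqr_radius_le andbT.
apply/eqP => E.
have : 1 *: xpart (F (chart_inv c q')) + 0 *: (xpart (F (chart_inv c q')) - 0) = 0.
  apply: (interior_critical Ac cq' q'0) => p'.
  by rewrite !mul1r !mul0r !addr0 E; exact: sqr_radius_le.
rewrite scale1r scale0r addr0 => x0; move: E; rewrite x0.
by rewrite dot00 => /esym/eqP; rewrite sqrf_eq0 gt_eqF // radius_gt0.
Qed.

(** A point [y] of the disk outside the image would give a maximum, at an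
    interior point, of [(w^2 - |x|^2) / |x - y|^2]. *)
Lemma disk_covered (y : 'rV[R]_n) : dot y y <= w zs ^+ 2 ->
  exists p, xpart (F p) = y.
Proof.
move=> yw; apply: contrapT => ny; have w0 := radius_gt0.
pose d p := dot (xpart (F p) - y) (xpart (F p) - y).
have d0 p : 0 < d p.
  by rewrite dot_gt0 subr_eq0; apply/eqP => E; apply: ny; exists p.
pose f p := (w zs ^+ 2 - dot (xpart (F p)) (xpart (F p))) / d p.
have cdist (v : 'rV[R]_n) p :
    {for p, continuous (fun p => dot (xpart (F p) - v) (xpart (F p) - v))}.
  apply: cont_at_sum => j.
  have cj : {for p, continuous (fun p => (xpart (F p) - v) 0 j)}.
    rewrite (_ : (fun p => _) = (fun p => F p 0 (lshift 1 j) - v 0 j)).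
      have := @immersion_cont _ _ _ _ _ _ _ hF (lshift 1 j) p => cF.
      exact: (cvgB cF (cvg_cst (v 0 j))).
    by apply/funext => p'; rewrite !mxE.
  exact: cont_at_mul.
have cf p : {for p, continuous f}.
  have c0 : {for p, continuous (fun p => dot (xpart (F p)) (xpart (F p)))}.
    rewrite (_ : (fun p => _) =
      (fun p => dot (xpart (F p) - 0) (xpart (F p) - 0))); first exact: cdist.
    by apply/funext => p'; rewrite subr0.
  have cV : {for p, continuous (fun p => (d p)^-1)}.
    by apply: cvgV; [rewrite gt_eqF ?d0 | exact: cdist].
  exact: (cont_at_mul (cvgB (cvg_cst (w zs ^+ 2)) c0) cV).
have [p1 small1] := exists_small.
have [p0 _ fmax] : exists2 p0, p0 \in [set: M] &
    forall p, p \in [set: M] -> f p <= f p0.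
  apply: compact_EVT_max; [by exists p1 | exact: (mfb_compact hF) |].
  by apply: continuous_in_subspaceT => p _; exact: cf.
have {}fmax p : f p <= f p0 by apply: fmax; rewrite inE.
have l0 : 0 < f p0.
  by apply: lt_le_trans (fmax p1); rewrite divr_gt0 // subr_gt0.
move lf : (f p0) l0 => l l0.
have lE : l * d p0 = w zs ^+ 2 - dot (xpart (F p0)) (xpart (F p0)).
  by rewrite -lf /f mulfVK // gt_eqF.
have small0 : dot (xpart (F p0)) (xpart (F p0)) < w zs ^+ 2.
  by rewrite -subr_gt0 -lE mulr_gt0.
have [c [Ac dp cq Hq _]] := chart_at hF p0.
have pos0 := interior_of_small Ac dp small0.
have : -1 *: xpart (F p0) + (- l) *: (xpart (F p0) - y) = 0.
  have := @interior_critical c (chart_map c p0) y (-1) (- l) Ac cq pos0.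
  rewrite /= (chart_mapK (mfd_chart (mfb_manifold hF) Ac) dp); apply=> p.
  have := fmax p; rewrite lf {1}/f ler_pdivrMr // -/(d p) -/(d p0) => h.
  by rewrite !mulN1r !mulNr lE; lra.
(* [y] is a multiple of the maximum point, and its squared length comes out as
   [(1 + l^-1) * w zs ^+ 2] *)
move=> crit; have xE : (1 + l) *: xpart (F p0) = l *: y.
  apply/eqP; rewrite -subr_eq0 -oppr_eq0 -[X in _ == X]crit; apply/eqP.
  by apply/rowP => j; rewrite !mxE; ring.
have dE : (1 + l) *: (xpart (F p0) - y) = - y.
  by rewrite scalerBr xE scalerDl scale1r opprD addrCA subrr addr0.
have e1 : (1 + l) ^+ 2 * dot (xpart (F p0)) (xpart (F p0)) = l ^+ 2 * dot y y.
  have := congr1 (fun v => dot v v) xE; rewrite /= !dotZl !dotZr => h.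
  by rewrite !expr2 -!mulrA.
have e2 : (1 + l) ^+ 2 * d p0 = dot y y.
  have := congr1 (fun v => dot v v) dE; rewrite /= dotZl dotZr dotNl dotNr opprK.
  by rewrite expr2 -mulrA.
have : (1 + l) * ((1 + l) * w zs ^+ 2) = (1 + l) * (l * dot y y).
  by rewrite mulrA -expr2 -[w zs ^+ 2](subrK (dot (xpart (F p0)) (xpart (F p0))))
    -lE mulrDr e1 mulrCA e2; ring.
have l1 : 1 + l != 0 by rewrite gt_eqF // addr_gt0.
move/(mulfI l1) => E; have : 0 < w zs ^+ 2 by rewrite exprn_gt0.
have : l * dot y y <= l * w zs ^+ 2 by rewrite ler_pM2l.
by move: E; lra.
Qed.

Lemma flat_range :
  range F = [set p | enorm (xpart p) <= w zs /\ zpart p = zs].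
Proof.
apply/seteqP; split=> [_ [p _ <-] | p /= [px pz]].
  by rewrite /= hz; split=> //; rewrite -(hz p); exact: hin.
have := px; rewrite (enorm_le _ (ltW radius_gt0)) => /disk_covered[p' E].
by exists p' => //; apply: eq_split; rewrite ?hz.
Qed.

End Flat.

Theorem theorem3p1 (R : realType) (n : nat) (hn : (2 <= n)%N)
    (w : R -> R) (P : set R) (hw : pinching_profile w P)
    (M : topologicalType) (A : set (chart R M n)) (F : M -> 'rV[R]_(n + 1))
    (hF : minimal_free_boundary A F w P)
    (hbd : bounded_set (range F))
    (z1 z2 : \bar R) (hneck : shrinking_neck w z1 z2)
    (hin : contained_in_region w z1 z2 (range F)) :
  standard_flat_disk w (range F).
Proof.
pose i0 : 'I_n := Ordinal (ltnW hn).
have i0E : i0 = 0%N :> nat by [].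
have inF p : enorm (xpart (F p)) <= w (zpart (F p)).
  by case: (hin (F p)); first exists p.
have inz p : (z1 < (zpart (F p))%:E < z2)%E.
  by case: (hin (F p)); first exists p.
have flat p0 : (forall p, zpart (F p) = zpart (F p0)) ->
    standard_flat_disk w (range F).
  by move=> hz; exists (zpart (F p0)); exact: (flat_range i0E hw hF inF hz).
(* either the height is constant, or its maximum lies on a decreasing part of
   [w] and its minimum on an increasing part *)
have [p1 max1] := height_max hF 1; have [p2 max2] := height_max hF (- 1).
have n1 : -1 != 0 :> R by rewrite oppr_eq0 oner_eq0.
have [[q1 [bd1 e1 w1]]|c1] := height_dichotomy i0E hw hF inF (oner_neq0 R) max1
  (ex_intro _ p1 erefl); last first.
  by apply: (flat p1) => p; have := c1 p; rewrite !mul1r.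
have [[q2 [bd2 e2 w2]]|c2] := height_dichotomy i0E hw hF inF n1 max2
  (ex_intro _ p2 erefl); last first.
  by apply: (flat p2) => p; have := c2 p; rewrite !mulN1r => /oppr_inj.
have [_ nP1] := boundary_cylinder hF bd1; have [_ nP2] := boundary_cylinder hF bd2.
rewrite mul1r in w1; rewrite mulN1r oppr_lt0 in w2.
have z21 : zpart (F q2) < zpart (F q1).
  rewrite lt_def; apply/andP; split.
    by apply: contraTneq w1 => ->; rewrite -leNgt ltW.
  by have := max1 q2; rewrite -e1 !mul1r.
have /andP[z1q2 _] := inz q2; have /andP[_ q1z2] := inz q1.
by case: (no_interior_hump hw hneck z21 z1q2 q1z2 nP2 nP1 w2 w1).
Qed.
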